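(* Let $I=(G=(V,E),\mathcal{C},\omega,\ell,b)$ be an instance of \textsc{Stars NWS} and let $E^*\subseteq E$. In polynomial time one can either find a solution $G'=(V,E')$ for $I$ with $E^*\subseteq E'$, $|E'|\le\ell$ and $\omega(E')\le b$, or correctly output that there is no minimum solution for $I$ that is fitting for $E^*$.
   Context: \textsc{Stars NWS}: given a graph $G=(V,E)$, a collection $\mathcal{C}$ of subsets of $V$ (communities), $\omega:E\to\mathbb{R}_+$, an integer $\ell$ and a positive real $b$, a solution is a spanning subgraph $G'=(V,E')$ with $E'\subseteq E$, $|E'|\le \ell$, $\omega(E')\le b$, such that for each $C\in\mathcal{C}$ the set $\mathrm{univ}_{G'}(C)$ of vertices $u\in C$ adjacent in $G'$ to all vertices of $C\setminus\{u\}$ is nonempty. A minimum solution is a solution with the minimum number of edges among all solutions. For a solution $G'$, two distinct communities $C_1,C_2$ induce a local cycle if there are $c_1\in\mathrm{univ}_{G'}(C_1)$, $c_2\in\mathrm{univ}_{G'}(C_2)$ such that the graph $S_1\cup S_2$ on vertex set $C_1\cup C_2$ with edge set $\{\{c_i,w\}: w\in C_i\setminus\{c_i\}, i\in\{1,2\}\}$ contains a cycle; every cycle of such $S_1\cup S_2$ is called a local cycle of $G'$. Given $E^*\subseteq E$ (whose elements are called local edges), a minimum solution $G'$ is fitting for $E^*$ if $E^*\subseteq E(G')$ and every local cycle of $G'$ uses only edges of $E^*$. *)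

(* Defs.v *)
From mathcomp Require Import all_boot all_order all_algebra.
From mathcomp Require Import reals.

Set Implicit Arguments.
Unset Strict Implicit.
Unset Printing Implicit Defensive.

Import Order.TTheory GRing.Theory Num.Theory.

Local Open Scope ring_scope.

(* Edges are two-element vertex sets.  The weight function is total on vertex *)
(* sets, but only its values on [edges] are ever used.                        *)
Record instance (R : realType) := Instance {
  nverts : nat;
  edges : {set {set 'I_nverts}};
  edges_card2 : forall e, e \in edges -> #|e| = 2%N;
  comms : {set {set 'I_nverts}};
  weight : {set 'I_nverts} -> R;
  weight_ge0 : forall e, e \in edges -> 0 <= weight e;
  max_edges : int;
  budget : R;
  budget_gt0 : 0 < budget
}.
Arguments weight {R} i e.

Section Graphs.
Variable V : finType.
Implicit Types (F : {set {set V}}) (C : {set V}) (p : seq V).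

Definition adj F : rel V := [rel x y | [set x; y] \in F].

Definition univ F C : {set V} :=
  [set u in C | [forall v in C :\ u, adj F u v]].

Definition star (c : V) C : {set {set V}} := [set [set c; w] | w in C :\ c].

Definition is_cycle F p : bool := [&& (2 < size p)%N, uniq p & cycle (adj F) p].

Definition cycle_edges p : {set {set V}} := [set [set x; next p x] | x in p].

End Graphs.

Section Solutions.
Variables (R : realType) (I : instance R).

Definition solution (E' : {set {set 'I_(nverts I)}}) : Prop :=
  [/\ E' \subset edges I,
      (#|E'|%:Z <= max_edges I),
      \sum_(e in E') weight I e <= budget I &
      forall C, C \in comms I -> univ E' C != set0].

Definition minimum_solution (E' : {set {set 'I_(nverts I)}}) : Prop :=
  solution E' /\ forall F, solution F -> (#|E'| <= #|F|)%N.

Definition local_cycle (E' : {set {set 'I_(nverts I)}})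
    (p : seq 'I_(nverts I)) : Prop :=
  exists C1 C2 : {set 'I_(nverts I)}, exists c1 c2 : 'I_(nverts I),
    [/\ [/\ C1 \in comms I, C2 \in comms I & C1 != C2],
        c1 \in univ E' C1, c2 \in univ E' C2 &
        is_cycle (star c1 C1 :|: star c2 C2) p].

Definition fitting (Es E' : {set {set 'I_(nverts I)}}) : Prop :=
  [/\ minimum_solution E', Es \subset E' &
      forall p, local_cycle E' p -> cycle_edges p \subset Es].

End Solutions.

(* Programs are written in a first-order functional language over binary      *)
(* trees with numeric leaves, and time is the number of evaluation steps      *)
(* (cf. N. D. Jones, Computability and Complexity from a Programming          *)
(* Perspective).  As in the real RAM, a real number occupies one cell, and    *)
(* one step suffices to add, subtract or compare two of them.  There is no    *)
(* multiplication, division or rounding, and 1 is the only constant: on       *)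
(* rational inputs the numbers computed in t steps have bit length polynomial *)
(* in t and the input, so polynomial time here entails polynomial time on a   *)
(* Turing machine.                                                            *)
Inductive data (R : Type) :=
  | Nil
  | Num of R
  | Pair of data R & data R.
Arguments Nil {R}.

Inductive expr :=
  | EVar of nat
  | ENil
  | EOne
  | EPair of expr & expr
  | EFst of expr
  | ESnd of expr
  | EAdd of expr & expr
  | ESub of expr & expr
  | ELe of expr & expr
  | EIf of expr & expr & expr
  | ELet of expr & expr
  | ECall of nat & expr.

(* The f-th entry is the body of the unary function called by [ECall f];      *)
(* function 0 is the entry point.                                             *)
Definition program := seq expr.

Section Semantics.
Variable R : realType.
Implicit Types (a b v : data R) (env : seq (data R)) (t : nat).

Fixpoint data_size v : nat :=
  if v is Pair a b then (data_size a + data_size b).+1 else 1%N.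

Definition dfst v : data R := if v is Pair a _ then a else Nil.
Definition dsnd v : data R := if v is Pair _ b then b else Nil.

Definition dadd a b : data R :=
  if (a, b) is (Num x, Num y) then Num (x + y) else Nil.
Definition dsub a b : data R :=
  if (a, b) is (Num x, Num y) then Num (x - y) else Nil.

(* [Nil] is false; every other value is true. *)
Definition dle a b : data R :=
  if (a, b) is (Num x, Num y) then (if x <= y then Num 1 else Nil) else Nil.
Definition dtrue v : bool := if v is Nil then false else true.

(* [eval P env e v t]: in [env] (de Bruijn indices), [e] has value [v] after  *)
(* [t] steps, one for each rule used.                                         *)
Inductive eval (P : program) : seq (data R) -> expr -> data R -> nat -> Prop :=
  | eval_var env i : eval P env (EVar i) (nth Nil env i) 1
  | eval_nil env : eval P env ENil Nil 1
  | eval_one env : eval P env EOne (Num 1) 1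
  | eval_pair env e1 e2 v1 v2 t1 t2 :
      eval P env e1 v1 t1 -> eval P env e2 v2 t2 ->
      eval P env (EPair e1 e2) (Pair v1 v2) (t1 + t2).+1
  | eval_fst env e v t :
      eval P env e v t -> eval P env (EFst e) (dfst v) t.+1
  | eval_snd env e v t :
      eval P env e v t -> eval P env (ESnd e) (dsnd v) t.+1
  | eval_add env e1 e2 v1 v2 t1 t2 :
      eval P env e1 v1 t1 -> eval P env e2 v2 t2 ->
      eval P env (EAdd e1 e2) (dadd v1 v2) (t1 + t2).+1
  | eval_sub env e1 e2 v1 v2 t1 t2 :
      eval P env e1 v1 t1 -> eval P env e2 v2 t2 ->
      eval P env (ESub e1 e2) (dsub v1 v2) (t1 + t2).+1
  | eval_le env e1 e2 v1 v2 t1 t2 :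
      eval P env e1 v1 t1 -> eval P env e2 v2 t2 ->
      eval P env (ELe e1 e2) (dle v1 v2) (t1 + t2).+1
  | eval_if env e e1 e2 b v t1 t2 :
      eval P env e b t1 -> eval P env (if dtrue b then e1 else e2) v t2 ->
      eval P env (EIf e e1 e2) v (t1 + t2).+1
  | eval_let env e1 e2 v1 v2 t1 t2 :
      eval P env e1 v1 t1 -> eval P (v1 :: env) e2 v2 t2 ->
      eval P env (ELet e1 e2) v2 (t1 + t2).+1
  | eval_call env f e v1 v2 t1 t2 :
      eval P env e v1 t1 -> eval P [:: v1] (nth ENil P f) v2 t2 ->
      eval P env (ECall f e) v2 (t1 + t2).+1.

Definition run (P : program) (x v : data R) (t : nat) : Prop :=
  eval P [:: x] (nth ENil P 0) v t.

Lemma eval_det (P : program) env e v v' t t' :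
  eval P env e v t -> eval P env e v' t' -> v = v' /\ t = t'.
Proof.
move=> H; elim: H v' t' => {env e v t}; intros;
  match goal with H : eval P _ _ ?v' _ |- _ = ?v' /\ _ => inversion H; subst end;
  by repeat match goal with
     | IH : forall v' t', eval P ?env ?e v' t' -> _,
       H : eval P ?env ?e _ _ |- _ =>
         let Ev := fresh in let Et := fresh in
         case: (IH _ _ H) => Ev Et; subst; clear IH
     end.
Qed.

Definition enc_list (s : seq (data R)) : data R := foldr (@Pair R) Nil s.

End Semantics.

Section Encoding.
Variable R : realType.

Definition enc_vset (n : nat) (A : {set 'I_n}) : data R :=
  enc_list [seq Num (val v)%:R | v <- enum A].

Definition enc_vsets (n : nat) (s : seq {set 'I_n}) : data R :=
  enc_list [seq enc_vset A | A <- s].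

Definition enc_input (I : instance R) (Es : {set {set 'I_(nverts I)}}) : data R :=
  enc_list
    [:: enc_vset [set: 'I_(nverts I)];
        enc_list [seq Pair (enc_vset e) (Num (weight I e)) | e <- enum (edges I)];
        enc_vsets (enum (comms I));
        Num (max_edges I)%:~R;
        Num (budget I);
        enc_vsets (enum Es)].

(* An edge set is returned as a list of its edges in any order, tagged so     *)
(* that even the empty set differs from the negative answer.                  *)
Definition answers_edges (n : nat) (v : data R) (E' : {set {set 'I_n}}) : Prop :=
  exists s : seq {set 'I_n}, v = Pair Nil (enc_vsets s) /\ E' = [set e in s].

Definition answers_no (v : data R) : Prop := v = Nil.

End Encoding.

(* Main.v *)
Require Import Defs.
From mathcomp Require Import all_boot all_order all_algebra.
From mathcomp Require Import reals zify.
(* MathComp shadows the constructors [Nil] and [Num]. *)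
Import Defs.

Set Implicit Arguments.
Unset Strict Implicit.
Unset Printing Implicit Defensive.

Import Order.TTheory GRing.Theory Num.Theory.

(* Call a vertex of a community [D] isolated if no local edge inside [D] covers
   it, and call communities [D], [D'] linked if they share at least two vertices,
   one of them isolated in [D] or [D'].  Ruling out triangles and squares among
   the local cycles shows that in a fitting solution the center of [D] is joined
   by local edges to all non-isolated vertices of [D], lies in every community
   linked to [D], and equals the center of every linked community that shares
   three vertices with [D].  Hence a non-local edge of the solution belongs to the
   stars of all communities containing it, and can be charged to the first of
   them.  The number of edges charged to [D] is the same for all centers with
   these properties, so a cheapest common center can be chosen independently for
   each class of communities that must share their center; the result is no
   larger and no heavier than the fitting solution.

   The algorithm is written with list folds only.  As every list it traverses is
   no longer than the input, its running time is bounded by a polynomial that can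
   be read off the program text. *)

(** * A language of bounded loops *)

(* [HFold l i b] is a right fold over the list [l] with initial value [i]; the
   body [b] sees the current element as variable 0 and the accumulator as
   variable 1. *)
Inductive hexp :=
  | HVar of nat
  | HNil
  | HOne
  | HPair of hexp & hexp
  | HFst of hexp
  | HSnd of hexp
  | HAdd of hexp & hexp
  | HSub of hexp & hexp
  | HLe of hexp & hexp
  | HIf of hexp & hexp & hexp
  | HLet of hexp & hexp
  | HFold of hexp & hexp & hexp.

Fixpoint nfuns (e : hexp) : nat :=
  match e with
  | HVar _ | HNil | HOne => 0
  | HFst a | HSnd a => nfuns a
  | HPair a b | HAdd a b | HSub a b | HLe a b | HLet a b => nfuns a + nfuns b
  | HIf a b c => nfuns a + nfuns b + nfuns c
  | HFold a b c => nfuns a + nfuns b + nfuns c + 1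
  end.

(* Compiled code keeps its whole environment, packed into one list, in
   variable 0, so that a loop can pass it on to its recursive call.  The loops
   of [e] are stored from position [o] of the program on. *)
Fixpoint compile (e : hexp) (o : nat) : expr :=
  match e with
  | HVar i => EFst (iter i ESnd (EVar 0))
  | HNil => ENil
  | HOne => EOne
  | HPair a b => EPair (compile a o) (compile b (o + nfuns a))
  | HFst a => EFst (compile a o)
  | HSnd a => ESnd (compile a o)
  | HAdd a b => EAdd (compile a o) (compile b (o + nfuns a))
  | HSub a b => ESub (compile a o) (compile b (o + nfuns a))
  | HLe a b => ELe (compile a o) (compile b (o + nfuns a))
  | HIf a b c => EIf (compile a o) (compile b (o + nfuns a))
                     (compile c (o + nfuns a + nfuns b))
  | HLet a b => ELet (EPair (compile a o) (EVar 0)) (compile b (o + nfuns a))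
  | HFold a b c => ECall (o + nfuns a + nfuns b + nfuns c)
                         (EPair (compile a o) (EVar 0))
  end.

(** The argument is the pair of the remaining list and the packed environment. On a nonempty list
    the body runs in that environment extended by the head and by the result of the recursive call
    on the tail. *)
Definition loop (f : nat) (i b : expr) : expr :=
  EIf (EFst (EVar 0))
    (ELet (EPair (EFst (EFst (EVar 0)))
             (EPair (ECall f (EPair (ESnd (EFst (EVar 0))) (ESnd (EVar 0))))
                    (ESnd (EVar 0)))) b)
    (ELet (ESnd (EVar 0)) i).

Fixpoint loops (e : hexp) (o : nat) : seq expr :=
  match e with
  | HVar _ | HNil | HOne => [::]
  | HFst a | HSnd a => loops a o
  | HPair a b | HAdd a b | HSub a b | HLe a b | HLet a b =>
      loops a o ++ loops b (o + nfuns a)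
  | HIf a b c =>
      loops a o ++ loops b (o + nfuns a) ++ loops c (o + nfuns a + nfuns b)
  | HFold a b c =>
      loops a o ++ loops b (o + nfuns a) ++ loops c (o + nfuns a + nfuns b) ++
      [:: loop (o + nfuns a + nfuns b + nfuns c)
            (compile b (o + nfuns a)) (compile c (o + nfuns a + nfuns b))]
  end.

(** [N] stands for a bound on the length of every list that is traversed. A conditional is charged
    for both branches, and the constants 20 generously cover the overhead of a round and of the
    initial call. *)
Fixpoint time_bound (N : nat) (e : hexp) : nat :=
  match e with
  | HVar i => i.+2
  | HNil | HOne => 1
  | HFst a | HSnd a => (time_bound N a).+1
  | HPair a b | HAdd a b | HSub a b | HLe a b =>
      (time_bound N a + time_bound N b).+1
  | HLet a b => time_bound N a + time_bound N b + 3
  | HIf a b c => (time_bound N a + time_bound N b + time_bound N c).+1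
  | HFold a b c =>
      time_bound N a + time_bound N b + N * (time_bound N c + 20) + 20
  end.

Lemma size_loops e o : size (loops e o) = nfuns e.
Proof.
elim: e o => //= [a IHa b IHb|a IHa b IHb|a IHa b IHb|a IHa b IHb|
  a IHa b IHb c IHc|a IHa b IHb|a IHa b IHb c IHc] o;
  by rewrite !size_cat ?IHa ?IHb ?IHc ?addnA.
Qed.

Definition loaded (P : program) (fs : seq expr) (o : nat) :=
  forall j, j < size fs -> nth ENil P (o + j) = nth ENil fs j.

Lemma loaded_cat P fs gs o :
  loaded P (fs ++ gs) o -> loaded P fs o /\ loaded P gs (o + size fs).
Proof.
move=> H; split=> j Hj.
  by rewrite H ?nth_cat ?Hj // size_cat; lia.
by rewrite -addnA H ?nth_cat ?size_cat ?ltn_add2l // ltnNge leq_addr /= addKn.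
Qed.

(** Sums are brought to a common exponent, the sum of the given ones; only a fold multiplies by [N]
    and so adds one more. *)
Lemma time_bound_poly e :
  exists c k, forall N, 0 < N -> time_bound N e <= c * N ^ k.
Proof.
have mono c k c' k' N : 0 < N -> c <= c' -> k <= k' -> c * N ^ k <= c' * N ^ k'.
  by move=> N0 cc kk; rewrite leq_mul // leq_pexp2l.
have sum3 f1 f2 f3 d :
    (exists c k, forall N, 0 < N -> f1 N <= c * N ^ k) ->
    (exists c k, forall N, 0 < N -> f2 N <= c * N ^ k) ->
    (exists c k, forall N, 0 < N -> f3 N <= c * N ^ k) ->
    exists c k, forall N, 0 < N -> f1 N + f2 N + f3 N + d <= c * N ^ k.
  move=> [c1 [k1 h1]] [c2 [k2 h2]] [c3 [k3 h3]].
  exists (c1 + c2 + c3 + d), (k1 + k2 + k3) => N N0.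
  have e1 := leq_trans (h1 N N0) (mono c1 k1 c1 (k1 + k2 + k3) N N0 (leqnn _) ltac:(lia)).
  have e2 := leq_trans (h2 N N0) (mono c2 k2 c2 (k1 + k2 + k3) N N0 (leqnn _) ltac:(lia)).
  have e3 := leq_trans (h3 N N0) (mono c3 k3 c3 (k1 + k2 + k3) N N0 (leqnn _) ltac:(lia)).
  have e4 : d <= d * N ^ (k1 + k2 + k3) by rewrite leq_pmulr // expn_gt0 N0.
  by rewrite !mulnDl !leq_add.
have const d : exists c k, forall N, 0 < N -> d <= c * N ^ k.
  by exists d, 0 => N _; rewrite muln1.
have eqb d f1 f2 f3 g : (forall N, f1 N + f2 N + f3 N + d = g N) ->
    (exists c k, forall N, 0 < N -> f1 N <= c * N ^ k) ->
    (exists c k, forall N, 0 < N -> f2 N <= c * N ^ k) ->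
    (exists c k, forall N, 0 < N -> f3 N <= c * N ^ k) ->
    exists c k, forall N, 0 < N -> g N <= c * N ^ k.
  move=> fg h1 h2 h3; have [c [k h]] := sum3 _ _ _ d h1 h2 h3.
  by exists c, k => N N0; rewrite -fg h.
have unary d f g : (forall N, f N + d = g N) ->
    (exists c k, forall N, 0 < N -> f N <= c * N ^ k) ->
    exists c k, forall N, 0 < N -> g N <= c * N ^ k.
  move=> fg h; apply: (eqb d f (fun=> 0) (fun=> 0)) => //.
  by move=> N; rewrite -fg !addn0.
have binary d f1 f2 g : (forall N, f1 N + f2 N + d = g N) ->
    (exists c k, forall N, 0 < N -> f1 N <= c * N ^ k) ->
    (exists c k, forall N, 0 < N -> f2 N <= c * N ^ k) ->
    exists c k, forall N, 0 < N -> g N <= c * N ^ k.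
  move=> fg h1 h2; apply: (eqb d f1 f2 (fun=> 0)) => //.
  by move=> N; rewrite -fg !addn0.
elim: e => /= [i|||a ha b hb|a ha|a ha|a ha b hb|a ha b hb|a ha b hb|
  a ha b hb c hc|a ha b hb|a ha b hb c hc]; try exact: const.
- by apply: (binary 1 _ _ _ _ ha hb) => N; rewrite addn1.
- by apply: (unary 1 _ _ _ ha) => N; rewrite addn1.
- by apply: (unary 1 _ _ _ ha) => N; rewrite addn1.
- by apply: (binary 1 _ _ _ _ ha hb) => N; rewrite addn1.
- by apply: (binary 1 _ _ _ _ ha hb) => N; rewrite addn1.
- by apply: (binary 1 _ _ _ _ ha hb) => N; rewrite addn1.
- by apply: (eqb 1 _ _ _ _ _ ha hb hc) => N; rewrite addn1.
- exact: (binary 3 _ _ _ _ ha hb).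
apply: (sum3 _ _ (fun N => N * (_ + 20)) 20) => //.
case: hc => d [k h]; exists (d + 20), k.+1 => N N0.
rewrite expnS mulnCA leq_mul2l mulnDl; apply/orP; right.
by apply: leq_add; rewrite ?h // leq_pmulr // expn_gt0 N0.
Qed.

(** * Compiled code computes the intended values within the time bound *)

Section Judgement.
Variables (R : realType) (N : nat).
Implicit Types (env : seq (data R)) (e : hexp) (v : data R).

(** The quantifier over [g] is there because compiled [ELet]s leave the older packed environments
    behind variable 0; those over [P] and [o] let a subexpression be compiled at any position. *)
Definition hval env e v : Prop :=
  forall (P : program) (o : nat) (g : seq (data R)),
    loaded P (loops e o) o ->
    exists2 t, eval P (enc_list env :: g) (compile e o) v t
             & t <= time_bound N e.

Lemma hval_var env i v : nth Nil env i = v -> hval env (HVar i) v.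
Proof.
move=> <- P o g _ /=; exists i.+2 => //.
(* Both sides are [Nil] when [i] is out of range, as projections of [Nil] are [Nil]. *)
have -> : nth Nil env i = dfst (iter i (@dsnd R) (enc_list env)).
  elim: i env => [|i IH] [|x env] //; rewrite iterSr -?IH //=.
  by elim: i {IH} => // i IH; rewrite iterSr.
apply: eval_fst; elim: i => [|i IH] /=; last exact: eval_snd.
exact: (eval_var P (enc_list env :: g) 0).
Qed.

Lemma hval_nil env : hval env HNil Nil.
Proof. by move=> P o g _; exists 1; first exact: eval_nil. Qed.

Lemma hval_one env : hval env HOne (Num 1%R).
Proof. by move=> P o g _; exists 1; first exact: eval_one. Qed.

Lemma hval_fst env a v : hval env a v -> hval env (HFst a) (dfst v).
Proof. by move=> h P o g /h-/(_ g)[t ? ?]; exists t.+1 => //; apply: eval_fst. Qed.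

Lemma hval_snd env a v : hval env a v -> hval env (HSnd a) (dsnd v).
Proof. by move=> h P o g /h-/(_ g)[t ? ?]; exists t.+1 => //; apply: eval_snd. Qed.

Local Ltac binary ctor :=
  move=> ha hb P o g /loaded_cat[/ha-/(_ g)[t1 e1 l1]];
  rewrite size_loops => /hb-/(_ g)[t2 e2 l2];
  eexists; [by apply: ctor; eassumption | rewrite /=; lia].

Lemma hval_pair env a b va vb :
  hval env a va -> hval env b vb -> hval env (HPair a b) (Pair va vb).
Proof. binary eval_pair. Qed.

Lemma hval_add env a b va vb :
  hval env a va -> hval env b vb -> hval env (HAdd a b) (dadd va vb).
Proof. binary eval_add. Qed.

Lemma hval_sub env a b va vb :
  hval env a va -> hval env b vb -> hval env (HSub a b) (dsub va vb).
Proof. binary eval_sub. Qed.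

Lemma hval_le env a b va vb :
  hval env a va -> hval env b vb -> hval env (HLe a b) (dle va vb).
Proof. binary eval_le. Qed.

Lemma hval_if env a b c va v :
  hval env a va -> hval env (if dtrue va then b else c) v ->
  hval env (HIf a b c) v.
Proof.
move=> ha hbc P o g /loaded_cat[/ha-/(_ g)[t1 e1 l1]].
rewrite size_loops => /loaded_cat[]; rewrite size_loops => lb lc.
have [t2 e2 l2] : exists2 t2,
    eval P (enc_list env :: g) (if dtrue va then compile b (o + nfuns a)
                                else compile c (o + nfuns a + nfuns b)) v t2
    & t2 <= time_bound N b + time_bound N c.
  case: (dtrue va) hbc => hbc; [case: (hbc _ _ g lb)|case: (hbc _ _ g lc)] => t e l;
    exists t => //; lia.
by exists (t1 + t2).+1; [exact: eval_if e1 e2 | rewrite /=; lia].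
Qed.

Lemma hval_let env a b va v :
  hval env a va -> hval (va :: env) b v -> hval env (HLet a b) v.
Proof.
move=> ha hb P o g /loaded_cat[/ha-/(_ g)[t1 e1 l1]].
rewrite size_loops => /hb-/(_ (enc_list env :: g))[t2 e2 l2].
exists ((t1 + 1).+1 + t2).+1; last by rewrite /=; lia.
apply: eval_let e2; apply: eval_pair e1 _.
exact: (eval_var P (enc_list env :: g) 0).
Qed.

(** Induction on [s]. The body only has to be correct on encoded accumulators, so an invariant of
    the loop is expressed by the choice of [A] and [encA]. *)
Lemma hval_fold (A B : Type) (encA : A -> data R) (encB : B -> data R)
    (F : B -> A -> A) z env l i b (s : seq B) :
  hval env l (enc_list (map encB s)) -> size s <= N -> hval env i (encA z) ->
  (forall x y, hval (encB x :: encA y :: env) b (encA (F x y))) ->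
  hval env (HFold l i b) (encA (foldr F z s)).
Proof.
move=> hl sN hi hb P o g /=.
move=> /loaded_cat[/hl-/(_ g)[tl el ll]].
rewrite size_loops => /loaded_cat[]; rewrite size_loops => lb.
move=> /loaded_cat[]; rewrite size_loops => lc.
move=> /(_ 0 isT) /=; rewrite addn0.
set f := o + _ + _ + _ => Pf.
have loopP : exists2 t, eval P [:: Pair (enc_list (map encB s)) (enc_list env)]
    (nth ENil P f) (encA (foldr F z s)) t
    & t <= size s * (time_bound N b + 20) + (time_bound N i + 6).
  have var0 (d : data R) g' : eval P (d :: g') (EVar 0) d 1.
    exact: (eval_var P (d :: g') 0).
  rewrite Pf /loop; elim: s {hl sN el} => [|x s [t et lt]] /=.
    have [t e lt] := hi P _ [:: Pair Nil (enc_list env)] lb.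
    exists (2 + (2 + t).+1).+1; last by lia.
    eapply eval_if; [exact/eval_fst/var0|rewrite /=].
    by eapply eval_let; [exact/eval_snd/var0|exact: e].
  set d := Pair (Pair _ _) _.
  have [t2 e2 lt2] := hb x (foldr F z s) P _ [:: d] lc.
  (* The steps of [loop] in order: the test, the head, the recursive call on the tail with its
     argument, the environment, and the body. *)
  exists (2 + ((3 + (((3 + 2).+1 + t).+1 + 2).+1).+1 + t2).+1).+1; last by lia.
  eapply eval_if; [exact/eval_fst/var0|rewrite /=].
  have eh : eval P [:: d] (EFst (EFst (EVar 0))) (encB x) 3.
    exact: (eval_fst (eval_fst (var0 d [::]))).
  have et' : eval P [:: d] (ESnd (EFst (EVar 0))) (enc_list (map encB s)) 3.
    exact: (eval_snd (eval_fst (var0 d [::]))).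
  have ed : eval P [:: d] (ESnd (EVar 0)) (enc_list env) 2.
    exact: (eval_snd (var0 d [::])).
  apply: (eval_let (eval_pair eh (eval_pair _ ed)) e2).
  by apply: (eval_call (eval_pair et' ed)); rewrite Pf.
have [t et lt] := loopP.
exists ((tl + 1).+1 + t).+1.
  apply: eval_call et; apply: eval_pair el _.
  exact: (eval_var P (enc_list env :: g) 0).
have : size s * (time_bound N b + 20) <= N * (time_bound N b + 20).
  by rewrite leq_mul2r sN orbT.
lia.
Qed.

End Judgement.

(** * The algorithm *)

Section Algorithm.
Variables (R : realType) (T : finType) (E Es comm : {set {set T}}).
Variable w : {set T} -> R.
Implicit Types (x y c u : T) (e C D : {set T}) (K : {set {set T}}).

Definition joined (S : {set {set T}}) x y :=
  has (fun e : {set T} => (x \in e) && (y \in e)) (enum S).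

Definition isolated D x :=
  ~~ has (fun y => (y != x) && joined Es y x) (enum D).

Definition linked k D D' :=
  (k <= #|D :&: D'|) &&
  has (fun x => (x \in D') && (isolated D x || isolated D' x)) (enum D).

Definition valid D c :=
  [&& c \in D,
      all (fun u => (u == c) || joined E c u) (enum D),
      all (fun u => [|| isolated D u, u == c | joined Es c u]) (enum D) &
      all (fun D' => linked 2 D D' ==> (c \in D')) (enum comm)].

(** One round of closure under [linked 3]. The disjunct [D == D'] keeps old members, since a
    community without isolated vertices is not linked to itself. *)
Definition grow K : {set {set T}} :=
  [set D | has (fun D' => (D == D') || linked 3 D D') [seq D' <- enum comm | D' \in K]].

(** The fold over [enum comm] serves as a counter: that many rounds reach every community connected
    to [C]. *)
Definition class C : seq {set T} :=
  let K := foldr (fun _ => grow) [set C] (enum comm) in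
  [seq D <- enum comm | D \in K].

(** The right fold lets earlier communities override later ones, so the result is the first
    community containing both vertices. *)
Definition owner x y : {set T} :=
  foldr (fun D r => if (x \in D) && (y \in D) then D else r) set0 (enum comm).

Definition owned D c u := [&& u != c, ~~ joined Es c u & owner c u == D].

(** When edges have two elements and [x != y], at most one term survives, so the sum acts as a
    weight lookup. *)
Definition pair_weight x y : R :=
  \sum_(e <- enum E) if (x \in e) && (y \in e) then w e else 0%R.

(** The weight of the non-local edges charged to the communities of [s] if all of them take the
    center [c]. *)
Definition class_weight (s : seq {set T}) c : R :=
  \sum_(D <- s) \sum_(u <- enum D) if owned D c u then pair_weight c u else 0%R.

Definition better s c (r : option T) :=
  if all (valid^~ c) s then
    if r is Some c' then
      if (class_weight s c <= class_weight s c')%R then Some c else r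
    else Some c
  else r.

Definition center C : option T := foldr (better (class C)) None (enum [set: T]).

Definition kept e :=
  has (fun e' => e' == e) (enum Es) ||
  has (fun C => (e \subset C) && (if center C is Some c then c \in e else false))
    (enum comm).

End Algorithm.

(** * Its implementation *)

Definition hand a b := HIf a b HNil.
Definition hor a b := HIf a HOne b.
Definition hnot a := HIf a HNil HOne.
Definition hzero := HSub HOne HOne.
Definition hhas l b := HFold l HNil (hor b (HVar 1)).
Definition hall l b := HFold l HOne (hand b (HVar 1)).
Definition hfilter l b := HFold l HNil (HIf b (HPair (HVar 0) (HVar 1)) (HVar 1)).
Definition hsum l b := HFold l hzero (HAdd b (HVar 1)).

(* The arguments of the following programs are indices of variables; [g] is
   that of the whole input. *)
Definition hverts g := HFst (HVar g).
Definition hedges g := HFst (HSnd (HVar g)).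
Definition hcomms g := HFst (HSnd (HSnd (HVar g))).
Definition hlimit g := HFst (HSnd (HSnd (HSnd (HVar g)))).
Definition hbudget g := HFst (HSnd (HSnd (HSnd (HSnd (HVar g))))).
Definition hlocal g := HFst (HSnd (HSnd (HSnd (HSnd (HSnd (HVar g)))))).

Definition heq x y := hand (HLe (HVar x) (HVar y)) (HLe (HVar y) (HVar x)).
(** Here and below, outer variables are shifted by two inside the body of a loop and by one under
    [HLet]. *)
Definition hmem x A := hhas (HVar A) (heq 0 x.+2).
Definition hsubset A B := hall (HVar A) (hmem 0 B.+2).
Definition heqset A B := hand (hsubset A B) (hsubset B A).
Definition hboth x y e := hand (hmem x e) (hmem y e).
Definition hjoined_local g x y := hhas (hlocal g) (hboth x.+2 y.+2 0).
Definition hjoined_edges g x y :=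
  hhas (hedges g) (HLet (HFst (HVar 0)) (hboth x.+3 y.+3 0)).
Definition hisolated g D x :=
  hnot (hhas (HVar D) (hand (hnot (heq 0 x.+2)) (hjoined_local g.+2 0 x.+2))).
Definition hlinked (k : hexp) g D D' :=
  hand (HLe k (hsum (HVar D) (HIf (hmem 0 D'.+2) HOne hzero)))
       (hhas (HVar D) (hand (hmem 0 D'.+2)
          (hor (hisolated g.+2 D.+2 0) (hisolated g.+2 D'.+2 0)))).
Definition htwo := HAdd HOne HOne.
Definition hthree := HAdd HOne htwo.
Definition hvalid g D c :=
  hand (hmem c D)
  (hand (hall (HVar D) (hor (heq 0 c.+2) (hjoined_edges g.+2 c.+2 0)))
  (hand (hall (HVar D) (hor (hisolated g.+2 D.+2 0)
                          (hor (heq 0 c.+2) (hjoined_local g.+2 c.+2 0))))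
        (hall (hcomms g) (hor (hnot (hlinked htwo g.+2 D.+2 0)) (hmem c.+2 0))))).
Definition hgrow g K :=
  hfilter (hcomms g)
    (hhas (HVar K.+2) (hor (heqset 2 0) (hlinked hthree g.+4 2 0))).
Definition hclass g C :=
  HFold (hcomms g) (hfilter (hcomms g) (heqset 0 C.+2)) (hgrow g.+2 1).
Definition howner g x y :=
  HFold (hcomms g) HNil (HIf (hboth x.+2 y.+2 0) (HVar 0) (HVar 1)).
Definition howned g D c u :=
  hand (hnot (heq u c)) (hand (hnot (hjoined_local g c u))
    (HLet (howner g c u) (heqset 0 D.+1))).
Definition hpair_weight g x y :=
  hsum (hedges g)
    (HLet (HFst (HVar 0)) (HIf (hboth x.+3 y.+3 0) (HSnd (HVar 1)) hzero)).
Definition hclass_weight g s c :=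
  hsum (HVar s) (hsum (HVar 0)
    (HIf (howned g.+4 2 c.+4 0) (hpair_weight g.+4 c.+4 0) hzero)).
Definition hbetter g s c r :=
  HIf (hall (HVar s) (hvalid g.+2 0 c.+2))
    (HIf (HVar r)
       (HIf (HLe (hclass_weight g s c) (HFst (HVar r)))
          (HPair (hclass_weight g s c) (HVar c)) (HVar r))
       (HPair (hclass_weight g s c) (HVar c)))
    (HVar r).
Definition hcenter g C :=
  HLet (hclass g C) (HFold (hverts g.+1) HNil (hbetter g.+3 2 0 1)).
Definition hkept g e :=
  hor (hhas (hlocal g) (heqset 0 e.+2))
    (hhas (hcomms g) (hand (hsubset e.+2 0)
       (HLet (hcenter g.+2 0)
          (HIf (HVar 0) (HLet (HSnd (HVar 0)) (hmem 0 e.+4)) HNil)))).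
(** The double negation turns the result of [hcenter] into a boolean. The last loop both filters the
    entries of the edge list and drops their weights. *)
Definition hmain :=
  HIf (hall (hcomms 0) (hnot (hnot (hcenter 2 0))))
    (HIf (hand
       (HLe (hsum (hedges 0) (HLet (HFst (HVar 0)) (HIf (hkept 3 0) HOne hzero)))
            (hlimit 0))
       (HLe (hsum (hedges 0) (HLet (HFst (HVar 0))
                                (HIf (hkept 3 0) (HSnd (HVar 1)) hzero)))
            (hbudget 0)))
      (HPair HNil (HFold (hedges 0) HNil (HLet (HFst (HVar 0))
         (HIf (hkept 3 0) (HPair (HVar 0) (HVar 2)) (HVar 2)))))
      HNil)
    HNil.

(** The entry point packs the input into an environment of length one; it occupies position 0, so
    the loops start at 1. *)
Definition main_program : program :=
  ELet (EPair (EVar 0) ENil) (compile hmain 1) :: loops hmain 1.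

(** * Values of the derived constructs *)

Section Combinators.
Variables (R : realType) (N : nat).
Implicit Types (env : seq (data R)).

Local Notation hval := (@hval R N).

Definition dbool (b : bool) : data R := if b then Num 1%R else Nil.

Lemma hval_and env a b x y :
  hval env a (dbool x) -> hval env b (dbool y) ->
  hval env (hand a b) (dbool (x && y)).
Proof.
move=> ha hb; apply: (hval_if ha); case: x {ha} => //=; exact: hval_nil.
Qed.

Lemma hval_or env a b x y :
  hval env a (dbool x) -> hval env b (dbool y) ->
  hval env (hor a b) (dbool (x || y)).
Proof.
move=> ha hb; apply: (hval_if ha); case: x {ha} => //=; exact: hval_one.
Qed.

Lemma hval_not env a v : hval env a v -> hval env (hnot a) (dbool (~~ dtrue v)).
Proof.
move=> ha; apply: (hval_if ha); case: (dtrue v); [exact: hval_nil|exact: hval_one].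
Qed.

Lemma dtrue_dbool b : dtrue (dbool b) = b.
Proof. by case: b. Qed.

Lemma hval_notb env a b :
  hval env a (dbool b) -> hval env (hnot a) (dbool (~~ b)).
Proof. by move=> /hval_not; rewrite dtrue_dbool. Qed.

Lemma hval_ifb env a b c x v :
  hval env a (dbool x) -> hval env (if x then b else c) v ->
  hval env (HIf a b c) v.
Proof. by move=> ha hbc; apply: (hval_if ha); rewrite dtrue_dbool. Qed.

Lemma hval_zero env : hval env hzero (Num 0%R).
Proof. by rewrite -(subrr 1%R); exact: hval_sub (hval_one _ _) (hval_one _ _). Qed.

Lemma hval_has (B : Type) (f : B -> data R) (p : pred B) env l b s :
  hval env l (enc_list (map f s)) -> size s <= N ->
  (forall x r, hval (f x :: r :: env) b (dbool (p x))) ->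
  hval env (hhas l b) (dbool (has p s)).
Proof.
move=> hl sN hb.
have -> : has p s = foldr (fun x r => p x || r) false s by elim: s {hl sN} => //= x s ->.
apply: (hval_fold hl sN); first exact: hval_nil.
by move=> x y; apply: hval_or; [exact: hb | apply: hval_var].
Qed.

Lemma hval_all (B : Type) (f : B -> data R) (p : pred B) env l b s :
  hval env l (enc_list (map f s)) -> size s <= N ->
  (forall x r, hval (f x :: r :: env) b (dbool (p x))) ->
  hval env (hall l b) (dbool (all p s)).
Proof.
move=> hl sN hb.
have -> : all p s = foldr (fun x r => p x && r) true s by elim: s {hl sN} => //= x s ->.
apply: (hval_fold hl sN); first exact: hval_one.
by move=> x y; apply: hval_and; [exact: hb | apply: hval_var].
Qed.

Lemma hval_filter (B : Type) (f : B -> data R) (p : pred B) env l b s :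
  hval env l (enc_list (map f s)) -> size s <= N ->
  (forall x r, hval (f x :: r :: env) b (dbool (p x))) ->
  hval env (hfilter l b) (enc_list (map f (filter p s))).
Proof.
move=> hl sN hb.
have -> : filter p s = foldr (fun x r => if p x then x :: r else r) [::] s.
  by elim: s {hl sN} => //= x s ->.
apply: (hval_fold (encA := fun r => enc_list (map f r)) hl sN); first exact: hval_nil.
move=> x y; apply: hval_ifb (hb _ _) _; case: (p x); last exact: hval_var.
by apply: hval_pair; apply: hval_var.
Qed.

Lemma hval_sum (B : Type) (f : B -> data R) (F : B -> R) env l b s :
  hval env l (enc_list (map f s)) -> size s <= N ->
  (forall x r, hval (f x :: r :: env) b (Num (F x))) ->
  hval env (hsum l b) (Num (\sum_(x <- s) F x)%R).
Proof.
move=> hl sN hb.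
have -> : (\sum_(x <- s) F x = foldr (fun x r => F x + r) 0 s)%R.
  by elim: s {hl sN} => [|x s IH]; rewrite ?big_nil ?big_cons //= IH.
apply: (hval_fold (encA := @Num R) hl sN); first exact: hval_zero.
move=> x y; apply: (hval_add (va := Num (F x)) (vb := Num y)) => //.
exact: hval_var.
Qed.

Lemma hval_le_num env a b (x y : R) :
  hval env a (Num x) -> hval env b (Num y) ->
  hval env (HLe a b) (dbool (x <= y)%R).
Proof. exact: hval_le. Qed.

End Combinators.

(** * The programs compute the functions of the algorithm *)

Section Programs.
Variables (R : realType) (I : instance R) (Es : {set {set 'I_(nverts I)}}).
Variable N : nat.
Hypotheses (nN : nverts I <= N) (EN : #|edges I| <= N)
  (CN : #|comms I| <= N) (EsN : #|Es| <= N).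

Local Notation V := 'I_(nverts I).
Local Notation hval := (@hval R N).
Local Notation var env i v := (nth Nil env i = v) (only parsing).
Local Notation input := (enc_input Es).
Local Notation vtx := (fun x : V => Num (val x)%:R%R : data R).
Local Notation dbool := (@dbool R).
Local Notation entry :=
  (fun e : {set V} => Pair (enc_vset R e) (Num (weight I e))).
Implicit Types (env : seq (data R)) (x y c u : V) (e A B C D : {set V}).
Implicit Types (g i j k : nat).

Lemma size_enum_set A : size (enum A) <= N.
Proof. by rewrite -cardE; apply: leq_trans (max_card _) _; rewrite card_ord. Qed.

Lemma size_enum_comms : size (enum (comms I)) <= N. Proof. by rewrite -cardE. Qed.
Lemma size_enum_edges : size (enum (edges I)) <= N. Proof. by rewrite -cardE. Qed.
Lemma size_enum_local : size (enum Es) <= N. Proof. by rewrite -cardE. Qed.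

Local Hint Resolve size_enum_set size_enum_comms size_enum_edges size_enum_local : core.

Section Input.
Variables (env : seq (data R)) (g : nat).
Hypothesis gP : nth Nil env g = input.

Local Ltac field :=
  repeat first [apply: (hval_fst (v := Pair _ _)) | apply: (hval_snd (v := Pair _ _))];
  exact: hval_var gP.

Lemma hval_verts : hval env (hverts g) (enc_list (map vtx (enum [set: V]))).
Proof. field. Qed.
Lemma hval_edges : hval env (hedges g) (enc_list (map entry (enum (edges I)))).
Proof. field. Qed.
Lemma hval_comms : hval env (hcomms g) (enc_list (map (@enc_vset R _) (enum (comms I)))).
Proof. field. Qed.
Lemma hval_limit : hval env (hlimit g) (Num (max_edges I)%:~R%R).
Proof. field. Qed.
Lemma hval_budget : hval env (hbudget g) (Num (budget I)).
Proof. field. Qed.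
Lemma hval_local : hval env (hlocal g) (enc_list (map (@enc_vset R _) (enum Es))).
Proof. field. Qed.

End Input.

Lemma hval_eq env i j x y :
  var env i (vtx x) -> var env j (vtx y) -> hval env (heq i j) (dbool (x == y)).
Proof.
move=> hx hy; have -> : (x == y) =
    ((val x)%:R <= (val y)%:R :> R)%R && ((val y)%:R <= (val x)%:R :> R)%R.
  by rewrite !ler_nat -eqn_leq.
by apply: hval_and; apply: hval_le_num; apply: hval_var.
Qed.

Lemma hval_mem env i j x A :
  var env i (vtx x) -> var env j (enc_vset R A) ->
  hval env (hmem i j) (dbool (x \in A)).
Proof.
move=> hx hA; have -> : (x \in A) = has (fun y => y == x) (enum A).
  by rewrite has_pred1 mem_enum.
apply: (hval_has (hval_var N hA)) => // y r; exact: hval_eq.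
Qed.

Lemma hval_subset env i j A B :
  var env i (enc_vset R A) -> var env j (enc_vset R B) ->
  hval env (hsubset i j) (dbool (A \subset B)).
Proof.
move=> hA hB; have -> : (A \subset B) = all (fun x => x \in B) (enum A).
  by apply/subsetP/allP => s x; have := s x; rewrite mem_enum.
apply: (hval_all (hval_var N hA)) => // y r; exact: hval_mem.
Qed.

Lemma hval_eqset env i j A B :
  var env i (enc_vset R A) -> var env j (enc_vset R B) ->
  hval env (heqset i j) (dbool (A == B)).
Proof. by move=> hA hB; rewrite eqEsubset; apply: hval_and; apply: hval_subset. Qed.

Lemma hval_both env i j k x y e :
  var env i (vtx x) -> var env j (vtx y) -> var env k (enc_vset R e) ->
  hval env (hboth i j k) (dbool ((x \in e) && (y \in e))).
Proof. by move=> hx hy he; apply: hval_and; apply: hval_mem. Qed.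

Lemma hval_joined_local env g i j x y :
  var env g input -> var env i (vtx x) -> var env j (vtx y) ->
  hval env (hjoined_local g i j) (dbool (joined Es x y)).
Proof.
move=> hg hx hy; apply: (hval_has (hval_local hg)) => // e r.
exact: hval_both.
Qed.

Lemma hval_joined_edges env g i j x y :
  var env g input -> var env i (vtx x) -> var env j (vtx y) ->
  hval env (hjoined_edges g i j) (dbool (joined (edges I) x y)).
Proof.
move=> hg hx hy; apply: (hval_has (hval_edges hg)) => // e r.
apply: (hval_let (va := enc_vset R e)); last exact: hval_both.
by apply: (hval_fst (v := Pair _ _)); apply: hval_var.
Qed.

Lemma hval_isolated env g i j D x :
  var env g input -> var env i (enc_vset R D) -> var env j (vtx x) ->
  hval env (hisolated g i j) (dbool (isolated Es D x)).
Proof.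
move=> hg hD hx; apply: hval_notb; apply: (hval_has (hval_var N hD)) => // y r.
by apply: hval_and; [apply/hval_notb/hval_eq | apply: hval_joined_local].
Qed.

Lemma hval_linked (m : nat) env h g i j D D' :
  hval env h (Num m%:R%R) ->
  var env g input -> var env i (enc_vset R D) -> var env j (enc_vset R D') ->
  hval env (hlinked h g i j) (dbool (linked Es m D D')).
Proof.
move=> hm hg hD hD'; apply: hval_and.
  have -> : (m <= #|D :&: D'|) =
    (m%:R <= \sum_(x <- enum D) (if x \in D' then 1 else 0) :> R)%R.
    rewrite big_enum -big_mkcondr sumr_const ler_nat; congr (_ <= _).
    by apply: eq_card => x; rewrite !inE.
  apply: hval_le_num => //; apply: (hval_sum (hval_var N hD)) => // x r.
  apply: (hval_ifb (hval_mem (x := x) (A := D') _ _)) => //.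
  by case: ifP => _; [exact: hval_one | exact: hval_zero].
apply: (hval_has (hval_var N hD)) => // x r; apply: hval_and.
  exact: hval_mem.
by apply: hval_or; apply: hval_isolated.
Qed.

Lemma hval_two env : hval env htwo (Num 2%:R%R).
Proof. exact: hval_add (hval_one _ _) (hval_one _ _). Qed.

Lemma hval_three env : hval env hthree (Num 3%:R%R).
Proof.
have := hval_add (hval_one N env) (hval_two env).
by rewrite /dadd -[3%:R%R]/(1 + 2%:R)%R.
Qed.

Lemma hval_valid env g i j D c :
  var env g input -> var env i (enc_vset R D) -> var env j (vtx c) ->
  hval env (hvalid g i j) (dbool (valid (edges I) Es (comms I) D c)).
Proof.
move=> hg hD hc; apply: hval_and; first exact: hval_mem.
apply: hval_and.
  apply: (hval_all (hval_var N hD)) => // x r.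
  by apply: hval_or; [apply: hval_eq | apply: hval_joined_edges].
apply: hval_and.
  apply: (hval_all (hval_var N hD)) => // x r.
  apply: hval_or; first exact: hval_isolated.
  by apply: hval_or; [apply: hval_eq | apply: hval_joined_local].
apply: (hval_all (hval_comms hg)) => // D' r; rewrite implybE.
apply: hval_or; last exact: hval_mem.
by apply/hval_notb/hval_linked => //; exact: hval_two.
Qed.

Lemma hval_grow env g i (K : {set {set V}}) :
  var env g input ->
  var env i (enc_list (map (@enc_vset R _) [seq D <- enum (comms I) | D \in K])) ->
  hval env (hgrow g i)
    (enc_list (map (@enc_vset R _)
       [seq D <- enum (comms I) | D \in grow Es (comms I) K])).
Proof.
move=> hg hK; apply: (hval_filter (hval_comms hg)) => // D r; rewrite inE.
apply: (hval_has (hval_var N (_ : var _ _ _))) => //; first exact: hK.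
  by rewrite size_filter (leq_trans (count_size _ _)).
move=> D' r'; apply: hval_or; first exact: hval_eqset.
by apply: hval_linked => //; exact: hval_three.
Qed.

Lemma hval_class env g i C :
  var env g input -> var env i (enc_vset R C) ->
  hval env (hclass g i) (enc_list (map (@enc_vset R _) (class Es (comms I) C))).
Proof.
move=> hg hC.
apply: (hval_fold (encA := fun K : {set {set V}} => enc_list
  (map (@enc_vset R _) [seq D <- enum (comms I) | D \in K])) (hval_comms hg)) => //.
  apply: (hval_filter (hval_comms hg)) => // D r.
  by rewrite inE; apply: hval_eqset.
by move=> D K; apply: hval_grow.
Qed.

Lemma hval_owner env g i j x y :
  var env g input -> var env i (vtx x) -> var env j (vtx y) ->
  hval env (howner g i j) (enc_vset R (owner (comms I) x y)).
Proof.
move=> hg hx hy; apply: (hval_fold (encA := @enc_vset R _) (hval_comms hg)) => //.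
  by rewrite /enc_vset enum_set0; exact: hval_nil.
move=> D A; apply: (hval_ifb (hval_both (x := x) (y := y) (e := D) _ _ _)) => //.
by case: ifP => _; apply: hval_var.
Qed.

Lemma hval_owned env g i j k D c u :
  var env g input -> var env i (enc_vset R D) -> var env j (vtx c) ->
  var env k (vtx u) ->
  hval env (howned g i j k) (dbool (owned Es (comms I) D c u)).
Proof.
move=> hg hD hc hu; apply: hval_and; first exact/hval_notb/hval_eq.
apply: hval_and; first exact/hval_notb/hval_joined_local.
by apply: (hval_let (hval_owner hg hc hu)); apply: hval_eqset.
Qed.

Lemma hval_pair_weight env g i j x y :
  var env g input -> var env i (vtx x) -> var env j (vtx y) ->
  hval env (hpair_weight g i j) (Num (pair_weight (edges I) (weight I) x y)).
Proof.
move=> hg hx hy; apply: (hval_sum (hval_edges hg)) => // e r.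
apply: (hval_let (va := enc_vset R e)).
  by apply: (hval_fst (v := Pair _ _)); apply: hval_var.
apply: (hval_ifb (hval_both (x := x) (y := y) (e := e) _ _ _)) => //.
case: ifP => _; last exact: hval_zero.
by apply: (hval_snd (v := Pair _ _)); apply: hval_var.
Qed.

Lemma hval_class_weight env g i j (s : seq {set V}) c :
  var env g input -> var env i (enc_list (map (@enc_vset R _) s)) ->
  size s <= N -> var env j (vtx c) ->
  hval env (hclass_weight g i j)
    (Num (class_weight (edges I) Es (comms I) (weight I) s c)).
Proof.
move=> hg hs sN hc; apply: (hval_sum (hval_var N hs)) => // D r.
apply: (hval_sum (f := vtx) (hval_var N _)) => // u r'.
apply: (hval_ifb (hval_owned (D := D) (c := c) (u := u) _ _ _ _)) => //.
by case: ifP => _; [apply: hval_pair_weight | exact: hval_zero].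
Qed.

(** The weight is stored next to the center so that [hbetter] can compare with the current best
    without recomputing it. *)
Definition enc_center (s : seq {set V}) (o : option V) : data R :=
  if o is Some c then
    Pair (Num (class_weight (edges I) Es (comms I) (weight I) s c)) (vtx c)
  else Nil.

Lemma hval_better env g i j k (s : seq {set V}) c o :
  var env g input -> var env i (enc_list (map (@enc_vset R _) s)) ->
  size s <= N -> var env j (vtx c) -> var env k (enc_center s o) ->
  hval env (hbetter g i j k)
    (enc_center s (better (edges I) Es (comms I) (weight I) s c o)).
Proof.
move=> hg hs sN hc ho; rewrite /better.
have hw := hval_class_weight hg hs sN hc.
have hp := hval_pair hw (hval_var N hc).
apply: (hval_ifb (hval_all (p := (valid (edges I) Es (comms I))^~ c)
                    (hval_var N hs) sN _)).
  by move=> D r; apply: hval_valid.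
case: ifP => _; last exact: hval_var.
apply: (hval_if (hval_var N ho)); case: o ho => [c'|] ho //=.
have hf := hval_fst (hval_var N ho).
apply: (hval_ifb (hval_le_num hw hf)).
by case: ifP => _ //; apply: hval_var.
Qed.

Lemma hval_center env g i C :
  var env g input -> var env i (enc_vset R C) ->
  hval env (hcenter g i)
    (enc_center (class Es (comms I) C)
       (center (edges I) Es (comms I) (weight I) C)).
Proof.
move=> hg hC; apply: (hval_let (hval_class hg hC)).
apply: (hval_fold (encA := enc_center (class Es (comms I) C))
          (hval_verts (_ : var _ _ _))) => //; first exact: hval_nil.
move=> c o; apply: hval_better => //=.
by rewrite size_filter (leq_trans (count_size _ _)).
Qed.

Lemma hval_kept env g i e :
  var env g input -> var env i (enc_vset R e) ->
  hval env (hkept g i) (dbool (kept (edges I) Es (comms I) (weight I) e)).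
Proof.
move=> hg he; apply: hval_or.
  by apply: (hval_has (hval_local hg)) => // e' r; apply: hval_eqset.
apply: (hval_has (hval_comms hg)) => // C r.
apply: hval_and; first exact: hval_subset.
apply: (hval_let (hval_center (C := C) _ _)) => //.
apply: (hval_if (hval_var N (erefl _))).
case: (center _ _ _ _ _) => [c|] /=; last exact: hval_nil.
apply: (hval_let (va := vtx c)); last exact: hval_mem.
by apply: (hval_snd (v := Pair _ _)); apply: hval_var.
Qed.

Definition found_all :=
  all (fun C => center (edges I) Es (comms I) (weight I) C) (enum (comms I)).

Definition output : {set {set V}} :=
  [set e in edges I | kept (edges I) Es (comms I) (weight I) e].

Definition accept :=
  found_all && ((#|output|%:Z <= max_edges I)%R &&
                (\sum_(e in output) weight I e <= budget I)%R).

Lemma hval_main :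
  hval [:: input] hmain
    (if accept then
       Pair Nil (enc_vsets R
         [seq e <- enum (edges I) | kept (edges I) Es (comms I) (weight I) e])
     else Nil).
Proof.
have hg : nth Nil [:: input] 0 = input by [].
rewrite /accept.
apply: (hval_ifb (hval_all (p := fun C => _ : bool) (hval_comms hg) _ _)) => //.
  move=> C r; have := hval_center (env := [:: enc_vset R C; r; input])
    (g := 2) (i := 0) erefl erefl.
  move=> /hval_not/hval_notb; rewrite negbK; set b := dtrue _.
  have -> : b = center (edges I) Es (comms I) (weight I) C.
    by rewrite /b; case: (center _ _ _ _ _).
  exact.
rewrite -/found_all; case: found_all => /=; last exact: hval_nil.
have entryP e r : hval [:: entry e, r & [:: input]] (HFst (HVar 0)) (enc_vset R e).
  by apply: (hval_fst (v := Pair _ _)); apply: hval_var.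
have keptP e r : hval [:: enc_vset R e; entry e; r; input] (hkept 3 0)
    (dbool (kept (edges I) Es (comms I) (weight I) e)) by apply: hval_kept.
have hc : hval [:: input]
    (hsum (hedges 0) (HLet (HFst (HVar 0)) (HIf (hkept 3 0) HOne hzero)))
    (Num #|output|%:R%R).
  have -> : (#|output|%:R = \sum_(e <- enum (edges I))
      if kept (edges I) Es (comms I) (weight I) e then 1 else 0 :> R)%R.
    rewrite big_enum -big_mkcondr sumr_const; congr (_ *+ _)%R.
    by apply: eq_card => e; rewrite !inE.
  apply: (hval_sum (hval_edges hg)) => // e r.
  apply: (hval_let (entryP e r)); apply: (hval_ifb (keptP e r)).
  by case: ifP => _; [exact: hval_one | exact: hval_zero].
have hw : hval [:: input]
    (hsum (hedges 0) (HLet (HFst (HVar 0)) (HIf (hkept 3 0) (HSnd (HVar 1)) hzero)))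
    (Num (\sum_(e in output) weight I e)%R).
  have -> : (\sum_(e in output) weight I e = \sum_(e <- enum (edges I))
      if kept (edges I) Es (comms I) (weight I) e then weight I e else 0)%R.
    rewrite big_enum -big_mkcondr; apply: eq_bigl => e; by rewrite !inE.
  apply: (hval_sum (hval_edges hg)) => // e r.
  apply: (hval_let (entryP e r)); apply: (hval_ifb (keptP e r)).
  case: ifP => _; last exact: hval_zero.
  by apply: (hval_snd (v := Pair _ _)); apply: hval_var.
have h1 := hval_le_num hc (hval_limit hg).
have h2 := hval_le_num hw (hval_budget hg).
apply: (hval_ifb (hval_and h1 h2)).
(* The program compares the number of edges with the limit inside [R]; the embedding of the integers
   preserves the order. *)
rewrite -[#|output|%:R%R]/(#|output|%:Z%:~R)%R ler_int.
case: ifP => _; last exact: hval_nil.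
apply: (hval_pair (hval_nil _ _)); rewrite /enc_vsets.
set p := kept _ _ _ _.
have -> : filter p (enum (edges I)) =
    foldr (fun e r => if p e then e :: r else r) [::] (enum (edges I)).
  by elim: (enum _) => //= e s ->.
apply: (hval_fold (encA := fun r => enc_list (map (@enc_vset R _) r))
          (hval_edges hg)) => //.
  exact: hval_nil.
move=> e r; apply: (hval_let (entryP e _)); apply: (hval_ifb (keptP e _)).
rewrite -/p; case: (p e); last exact: hval_var.
by apply: hval_pair; apply: hval_var.
Qed.

End Programs.

(** * Correctness of the algorithm *)

Section SetFacts.
Variable T : finType.
Implicit Types (x y z t : T) (e : {set T}) (p : seq T).

Lemma set2_uniq e x y :
  #|e| = 2 -> x \in e -> y \in e -> x != y -> e = [set x; y].
Proof.
move=> e2 xe ye xy; apply/eqP; rewrite eq_sym eqEcard e2 cards2 xy andbT.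
by rewrite subUset !sub1set xe.
Qed.

Lemma exists_other (A : {set T}) x : 1 < #|A| -> exists2 y, y \in A & y != x.
Proof.
move=> A1; case: (set_0Vmem (A :\ x)) => [/eqP|[y /setD1P[yx yA]]].
  by rewrite setD_eq0 => /subset_leq_card; rewrite cards1 leqNgt A1.
by exists y.
Qed.

Lemma card2_split e x :
  #|e| = 2 -> x \in e -> exists2 y, y != x & e = [set x; y].
Proof.
move=> e2 xe; have [|y ye yx] := @exists_other e x; first by rewrite e2.
by exists y => //; apply: set2_uniq => //; rewrite eq_sym.
Qed.

Lemma exists_third (A : {set T}) x y :
  2 < #|A| -> exists z, [/\ z \in A, z != x & z != y].
Proof.
move=> A2; case: (set_0Vmem (A :\: [set x; y])) => [/eqP|[z]].
  rewrite setD_eq0 => /subset_leq_card; rewrite cards2 => /(leq_trans A2).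
  by case: (x != y).
by rewrite !inE negb_or => /andP[/andP[zx zy] zA]; exists z.
Qed.

Lemma cycle_edges3 x y z :
  uniq [:: x; y; z] ->
  [/\ [set x; y] \in cycle_edges [:: x; y; z],
      [set y; z] \in cycle_edges [:: x; y; z] &
      [set x; z] \in cycle_edges [:: x; y; z]].
Proof.
move=> /and3P[]; rewrite !inE negb_or => /andP[xy xz] yz _.
split; apply/imsetP; [exists x|exists y|exists z]; rewrite ?inE ?eqxx ?orbT //=.
- by rewrite eqxx.
- by move: xy; rewrite eq_sym => /negPf->; rewrite eqxx.
- move: xz yz; rewrite eq_sym => /negPf->; rewrite eq_sym => /negPf->.
  by rewrite eqxx setUC.
Qed.

Lemma cycle_edges4 x y z t :
  uniq [:: x; y; z; t] ->
  [/\ [set x; y] \in cycle_edges [:: x; y; z; t] &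
      [set y; z] \in cycle_edges [:: x; y; z; t]].
Proof.
move=> /and4P[]; rewrite !inE !negb_or => /and3P[xy xz xt] /andP[yz yt] zt _.
split; apply/imsetP; [exists x|exists y]; rewrite ?inE ?eqxx ?orbT //=.
  by rewrite eqxx.
by move: xy; rewrite eq_sym => /negPf->; rewrite eqxx.
Qed.

Lemma ler_sum_subset (R : realType) (A B : {set T}) (f : T -> R) :
  A \subset B -> (forall x, x \in B -> 0 <= f x)%R ->
  (\sum_(x in A) f x <= \sum_(x in B) f x)%R.
Proof.
move=> /setIidPr AB f0; rewrite [leRHS](big_setID A) /= AB lerDl sumr_ge0 // => x.
by rewrite inE => /andP[_ /f0].
Qed.

End SetFacts.

Section Correctness.
Variables (R : realType) (I : instance R) (Es : {set {set 'I_(nverts I)}}).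
Hypothesis EsE : Es \subset edges I.

Local Notation V := 'I_(nverts I).
Local Notation E := (edges I).
Local Notation CC := (comms I).
Local Notation joined := (@joined V).
Local Notation isolated := (isolated Es).
Local Notation linked := (linked Es).
Local Notation valid := (valid E Es CC).
Local Notation class := (class Es CC).
Local Notation owned := (owned Es CC).
Local Notation center := (center E Es CC (weight I)).
Local Notation kept := (kept E Es CC (weight I)).
Local Notation output := (output Es).
Local Notation class_weight := (class_weight E Es CC (weight I)).
Implicit Types (x y c u : V) (e C D : {set V}) (S : {set {set V}}).

Lemma joinedE S x y :
  S \subset E -> x != y -> joined S x y = ([set x; y] \in S).
Proof.
move=> SE xy; apply/hasP/idP => [[e]|xyS]; last first.
  by exists [set x; y]; rewrite ?mem_enum // !inE !eqxx orbT.
rewrite mem_enum => eS /andP[xe ye].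
by rewrite -(set2_uniq (edges_card2 (subsetP SE _ eS)) xe ye xy).
Qed.

Lemma isolatedPn D x :
  reflect (exists y, [/\ y \in D, y != x & [set x; y] \in Es]) (~~ isolated D x).
Proof.
rewrite negbK; apply: (iffP hasP) => [[y]|[y [yD yx xyE]]].
  rewrite mem_enum => yD /andP[yx]; rewrite joinedE // setUC => xyE.
  by exists y.
by exists y; rewrite ?mem_enum // yx joinedE // setUC.
Qed.

Lemma linkedP k D D' :
  reflect (k <= #|D :&: D'| /\
           exists x, [/\ x \in D, x \in D' & isolated D x || isolated D' x])
    (linked k D D').
Proof.
apply: (iffP andP) => -[kD].
  by case/hasP => x; rewrite mem_enum => xD /andP[xD' i]; split=> //; exists x.
by case=> x [xD xD' i]; split=> //; apply/hasP; exists x; rewrite ?mem_enum ?xD'.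
Qed.

Lemma linked_sym k D D' : linked k D D' = linked k D' D.
Proof.
by apply/linkedP/linkedP; rewrite setIC => -[kD [x [xD xD' i]]];
  split=> //; exists x; rewrite orbC.
Qed.

Lemma validP D c :
  reflect [/\ c \in D,
              forall u, u \in D -> u != c -> [set c; u] \in E,
              forall u, u \in D -> u != c -> ~~ isolated D u -> [set c; u] \in Es &
              forall D', D' \in CC -> linked 2 D D' -> c \in D']
    (valid D c).
Proof.
apply: (iffP and4P) => -[cD h1 h2 h3]; split=> //.
- move=> u uD uc; have := allP h1 u; rewrite mem_enum (negPf uc) => /(_ uD) /=.
  by rewrite joinedE // eq_sym.
- move=> u uD uc iu; have := allP h2 u; rewrite mem_enum (negPf uc) (negPf iu).
  by move=> /(_ uD) /=; rewrite joinedE // eq_sym.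
- by move=> D' D'C; have := allP h3 D'; rewrite mem_enum => /(_ D'C)/implyP.
- apply/allP => u; rewrite mem_enum => uD; have [//|uc] := eqVneq u c.
  by rewrite joinedE ?h1 // eq_sym.
- apply/allP => u; rewrite mem_enum => uD; have [//|uc] := eqVneq u c.
    by rewrite orbT.
  by case: (boolP (isolated D u)) => // iu /=; rewrite joinedE ?h2 // eq_sym.
- by apply/allP => D'; rewrite mem_enum => D'C; apply/implyP/h3.
Qed.

(** * Classes as connected components of the link graph *)

Definition link : rel {set V} :=
  [rel D D' | [&& D \in CC, D' \in CC & linked 3 D D']].

Lemma link_sym : connect_sym link.
Proof.
by apply: sym_connect_sym => D D'; apply/and3P/and3P => -[? ? ?]; split;
  rewrite // linked_sym.
Qed.

Lemma classE C : C \in CC -> class C = [seq D <- enum CC | connect link C D].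
Proof.
move=> CC_C; rewrite /class.
have -> s : foldr (fun _ : {set V} => grow Es CC) [set C] s =
    iter (size s) (grow Es CC) [set C] by elim: s => //= D s ->.
rewrite -cardE; apply: eq_in_filter => D; rewrite mem_enum => DC.
apply/idP/idP.
  elim: #|CC| D DC => [|k IH] D DC; first by rewrite inE => /eqP->.
  rewrite /= inE => /hasP[D']; rewrite mem_filter mem_enum.
  case/andP => kD' D'C /orP[/eqP->|l]; first exact: IH.
  apply: connect_trans (IH _ D'C kD') (connect1 _).
  by apply/and3P; split; rewrite // linked_sym.
(* Extra rounds lose no community, so a path shorter than the number of rounds is enough. *)
have mono k j D' : D' \in CC -> D' \in iter k (grow Es CC) [set C] ->
    D' \in iter (j + k) (grow Es CC) [set C].
  move=> D'C kD'; elim: j => //= j IH; rewrite inE.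
  by apply/hasP; exists D'; rewrite ?eqxx // mem_filter IH mem_enum.
(* A path without repetition visits at most [#|CC|] communities, which bounds its length. *)
move=> /connectP[p0 /shortenP[p pp up _] ->] {p0 D DC}.
have pC : all (mem CC) (C :: p).
  rewrite /= CC_C /=; elim: p C pp {up mono CC_C} => //= D p IH C.
  by case/andP => /and3P[_ -> _] /IH ->.
have pk : size p <= #|CC|.
  have : size (C :: p) <= #|CC|; last exact: ltnW.
  rewrite -(card_uniqP up); apply/subset_leq_card/subsetP => D.
  by move/(allP pC).
rewrite -(subnK pk); apply: mono; first by apply: (allP pC); exact: mem_last.
elim/last_ind: p pp pC {up pk} => [|p D IH]; first by rewrite inE.
rewrite rcons_path last_rcons size_rcons -rcons_cons all_rcons /=.
case/andP=> pp /and3P[lC DC l] /andP[_ pC]; rewrite inE; apply/hasP.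
exists (last C p); last by rewrite linked_sym l orbT.
by rewrite mem_filter IH // mem_enum.
Qed.

Lemma mem_class C D : C \in CC -> (D \in class C) = (D \in CC) && connect link C D.
Proof. by move=> /classE->; rewrite mem_filter mem_enum andbC. Qed.

Lemma class_self C : C \in CC -> C \in class C.
Proof. by move=> CC_C; rewrite mem_class // CC_C connect0. Qed.

Lemma class_eq C D : C \in CC -> D \in class C -> class D = class C.
Proof.
move=> CC_C; rewrite mem_class // => /andP[DC cCD].
by rewrite !classE //; apply: eq_filter => D'; rewrite (same_connect link_sym cCD).
Qed.

Lemma linked_class C D : C \in CC -> D \in CC -> linked 3 C D -> D \in class C.
Proof.
by move=> CC_C DC l; rewrite mem_class // DC connect1 //; apply/and3P.
Qed.

(** * Computed centers and soundness of acceptance *)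

Lemma centerP C :
  if center C is Some a then
    all (valid^~ a) (class C) /\
    forall c, all (valid^~ c) (class C) ->
      (class_weight (class C) a <= class_weight (class C) c)%R
  else forall c, ~~ all (valid^~ c) (class C).
Proof.
rewrite /center; set s := class C.
(* Optimality restricted to the vertices already scanned is the invariant of the fold. *)
suff : if foldr (better E Es CC (weight I) s) None (enum [set: V]) is Some a then
    all (valid^~ a) s /\
    forall c, c \in enum [set: V] -> all (valid^~ c) s ->
      (class_weight s a <= class_weight s c)%R
  else forall c, c \in enum [set: V] -> ~~ all (valid^~ c) s.
  case: foldr => [a [va min]|no].
    by split=> // c; apply: min; rewrite mem_enum inE.
  by move=> c; apply: no; rewrite mem_enum inE.
elim: (enum _) => [|c l] //=; rewrite /better.
case: (foldr _ _ _) => [a [va min]|no].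
  case: ifP => vc; last first.
    split=> // c'; rewrite inE => /orP[/eqP->|]; [by rewrite vc | exact: min].
  case: leP => cmp; split=> // c'; rewrite inE => /orP[/eqP->|] //.
  - by move=> lc' vc'; apply: le_trans cmp (min _ lc' vc').
  - by move=> _; apply: ltW.
  - exact: min.
case: ifP => vc.
  split=> // c'; rewrite inE => /orP[/eqP->|/no/negPf->] //.
by move=> c'; rewrite inE => /orP[/eqP->|/no] //; rewrite vc.
Qed.

Lemma local_sub_output : Es \subset output.
Proof.
apply/subsetP => e eEs; rewrite inE (subsetP EsE) //=; apply/orP; left.
by apply/hasP; exists e; rewrite ?mem_enum.
Qed.

(** The center computed for [C] is valid in [C] itself, so its star lies in the graph; all edges of
    that star are kept, which makes the center universal. *)
Lemma accept_sound : accept Es -> solution output.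
Proof.
case/andP => /allP found /andP[cnt wt]; split=> //.
  by apply/subsetP => e; rewrite inE => /andP[].
move=> C CC_C; have := found C; rewrite mem_enum => /(_ CC_C).
have := centerP C; case ca: (center C) => [a|//] [/allP va _] _.
have /validP[aC aE _ _] := va _ (class_self CC_C).
apply/set0Pn; exists a; rewrite inE aC; apply/forall_inP => u.
rewrite !inE => /andP[ua uC]; rewrite /adj /= inE aE //=; apply/orP; right.
apply/hasP; exists C; rewrite ?mem_enum // ca subUset !sub1set aC uC /=.
by rewrite !inE eqxx.
Qed.

(** * Charging edges to communities *)

Definition edge_owner e : {set V} :=
  foldr (fun D r => if e \subset D then D else r) set0 (enum CC).

Lemma ownerE x y : owner CC x y = edge_owner [set x; y].
Proof.
by rewrite /owner /edge_owner; elim: (enum _) => //= D s ->; rewrite subUset !sub1set.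
Qed.

Lemma edge_ownerP e D :
  D \in CC -> e \subset D -> edge_owner e \in CC /\ e \subset edge_owner e.
Proof.
rewrite /edge_owner -!(mem_enum CC); elim: (enum CC) => //= C s IH.
rewrite !inE; case: ifP => [eC _ _|eC]; first by rewrite eqxx.
case/orP => [/eqP->|Ds eD]; first by rewrite eC.
by have [-> ->] := IH Ds eD; rewrite orbT.
Qed.

Lemma ownedE D c u :
  owned D c u = [&& u != c, [set c; u] \notin Es & edge_owner [set c; u] == D].
Proof.
rewrite /owned ownerE; case: (eqVneq u c) => //= uc.
by rewrite joinedE // eq_sym.
Qed.

Lemma pair_weightE x y :
  x != y -> [set x; y] \in E -> pair_weight E (weight I) x y = weight I [set x; y].
Proof.
move=> xy xyE; rewrite /pair_weight big_enum -big_mkcondr /= (big_pred1 [set x; y]) //.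
move=> e /=; apply/andP/eqP => [[eE /andP[xe ye]]|->]; last first.
  by rewrite xyE !inE !eqxx orbT.
exact: set2_uniq (edges_card2 eE) xe ye xy.
Qed.

(* Two valid centers of [D] own the same vertices, up to exchanging the two
   centers: an edge [{c, u}] that is not local links [D] to every community
   containing it, which must then also contain the other center. *)
Lemma card_owned D c c' :
  valid D c -> valid D c' -> D \in CC ->
  #|[set u in D | owned D c u]| = #|[set u in D | owned D c' u]|.
Proof.
move=> /validP[cD cE ciso clink] /validP[c'D c'E c'iso c'link] DC.
have [->//|cc'] := eqVneq c c'.
(* A center reaches non-isolated vertices by local edges, so a non-local star edge ends in an
   isolated vertex. *)
have own x y : x != y -> [set x; y] \notin Es -> x \in D -> y \in D ->
   (forall u, u \in D -> u != x -> ~~ isolated D u -> [set x; u] \in Es) ->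
   isolated D y.
  move=> xy nE xD yD h; apply: contraT => iy; have := h y yD; rewrite eq_sym xy iy.
  by rewrite (negPf nE) => /(_ isT isT).
have key x y : x \in D -> y \in D ->
    (forall u, u \in D -> u != x -> ~~ isolated D u -> [set x; u] \in Es) ->
    (forall D', D' \in CC -> linked 2 D D' -> x \in D') ->
    (forall D', D' \in CC -> linked 2 D D' -> y \in D') ->
    forall u, u \in D -> u != y -> owned D x u -> owned D y u.
  move=> xD yD hx lx ly u uD uy.
  rewrite !ownedE uy => /and3P[ux nE /eqP ow] /=.
  have iu : isolated D u by apply: (own x u) => //; rewrite eq_sym.
  have nE' : [set y; u] \notin Es.
    apply: contraL iu => yuE; apply/isolatedPn; exists y.
    by rewrite yD eq_sym uy setUC.
  rewrite nE' /=; apply/eqP; rewrite -[RHS]ow.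
  (* A community containing [u] and one of the centers is linked to [D] through the isolated [u],
     hence contains the other center too. So both edges have the same first community. *)
  have same D' : D' \in CC -> ([set y; u] \subset D') = ([set x; u] \subset D').
    move=> D'C; rewrite !subUset !sub1set.
    case uD' : (u \in D'); rewrite ?andbF ?andbT //.
    have lnk z : z \in D -> z \in D' -> u != z -> linked 2 D D'.
      move=> zD zD' uz; apply/linkedP; split; last by exists u; rewrite iu.
      have <- : #|[set u; z]| = 2 by rewrite cards2 uz.
      by apply/subset_leq_card; rewrite subUset !sub1set !inE uD uD' zD.
    apply/idP/idP => zD'; [apply: lx => //|apply: ly => //].
      exact: (lnk y).
    exact: (lnk x).
  rewrite /edge_owner; have : {subset enum CC <= CC} by move=> ?; rewrite mem_enum.
  elim: (enum CC) => //= C s IH sub; rewrite same ?IH //.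
    by move=> C' C's; apply: sub; rewrite inE C's orbT.
  by apply: sub; rewrite inE eqxx.
(* Each center may own the other one, by the same edge; these two cases are split off and match. *)
rewrite (cardsD1 c') [RHS](cardsD1 c); congr (_ + _).
  by rewrite !inE cD c'D !ownedE /= [c' == c]eq_sym cc' [[set c'; c]]setUC.
apply: eq_card => u; rewrite !inE.
case uD: (u \in D) => /=; rewrite ?andbF //.
have [->|uc'] := eqVneq u c'; first by rewrite [owned D c' c']ownedE eqxx andbF.
have [->|uc] := eqVneq u c; first by rewrite [owned D c c]ownedE eqxx.
by apply/idP/idP; apply: key.
Qed.

(** * Centers in a fitting solution *)

Section Fitting.
Variable E' : {set {set V}}.
Hypothesis fitE : fitting Es E'.

Let sE : E' \subset E. Proof. by have [[[]]] := fitE. Qed.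
Let EsE' : Es \subset E'. Proof. by have [_] := fitE. Qed.

Lemma univP C c :
  c \in univ E' C -> c \in C /\ forall u, u \in C -> u != c -> [set c; u] \in E'.
Proof.
rewrite inE => /andP[cC /forall_inP h]; split=> // u uC uc.
by have := h u; rewrite !inE uC uc => /(_ isT).
Qed.

Lemma star_mem c u C : u \in C -> u != c -> [set c; u] \in star c C.
Proof. by move=> uC uc; apply: imset_f; rewrite !inE uc. Qed.

(** The first star contributes the two edges at [c1], the second one the edge from [c2] to [x]. *)
Lemma local_triangle C1 C2 c1 c2 x :
  C1 \in CC -> C2 \in CC -> C1 != C2 ->
  c1 \in univ E' C1 -> c2 \in univ E' C2 -> c1 != c2 -> c2 \in C1 ->
  x \in C1 -> x \in C2 -> x != c1 -> x != c2 ->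
  [/\ [set c1; c2] \in Es, [set c2; x] \in Es & [set c1; x] \in Es].
Proof.
move=> hC1 hC2 C12 u1 u2 c12 c2C1 x1 x2 xc1 xc2.
have up : uniq [:: c1; c2; x] by rewrite /= !inE negb_or c12 eq_sym xc1 eq_sym xc2.
have /subsetP sub : cycle_edges [:: c1; c2; x] \subset Es.
  have [_ _] := fitE; apply; exists C1, C2, c1, c2; split=> //.
  apply/and3P; split=> //=; rewrite /adj /= !inE andbT.
  by apply/and3P; split; apply/orP; [left|right|left; rewrite setUC];
    apply: star_mem => //; rewrite eq_sym.
by have [/sub ? /sub ? /sub ?] := cycle_edges3 up.
Qed.

(** The cycle runs through [c1], [x], [c2], [y]; its two edges at [x] are the ones recorded. *)
Lemma local_square C1 C2 c1 c2 x y :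
  C1 \in CC -> C2 \in CC -> C1 != C2 ->
  c1 \in univ E' C1 -> c2 \in univ E' C2 -> c1 != c2 ->
  x \in C1 -> x \in C2 -> x != c1 -> x != c2 ->
  y \in C1 -> y \in C2 -> y != c1 -> y != c2 -> x != y ->
  [set c1; x] \in Es /\ [set c2; x] \in Es.
Proof.
move=> hC1 hC2 C12 u1 u2 c12 x1 x2 xc1 xc2 y1 y2 yc1 yc2 xy.
have up : uniq [:: c1; x; c2; y].
  by rewrite /= !inE !negb_or c12 xy xc2 eq_sym xc1 eq_sym yc1 eq_sym yc2.
have /subsetP sub : cycle_edges [:: c1; x; c2; y] \subset Es.
  have [_ _] := fitE; apply; exists C1, C2, c1, c2; split=> //.
  apply/and3P; split=> //=; rewrite /adj /= !inE andbT.
  by apply/and4P; split; apply/orP;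
    [left|right; rewrite setUC|right|left; rewrite setUC]; apply: star_mem.
by have [/sub ? /sub h] := cycle_edges4 up; rewrite [[set c2; x]]setUC.
Qed.

(* The chosen stars alone form a solution, so by minimality they make up [E']. *)
Lemma min_star e : e \in E' ->
  forall h : {set V} -> V, (forall C, C \in CC -> h C \in univ E' C) ->
  exists2 C, C \in CC & e \in star (h C) C.
Proof.
move=> eE h hP; pose F := \bigcup_(C in CC) star (h C) C.
have FE : F \subset E'.
  apply/bigcupsP => C hC; apply/subsetP => _ /imsetP[u /setD1P[uc uC] ->].
  by have [_] := univP (hP C hC); apply.
suff /eqP : F == E' by move=> FE'; move: eE; rewrite -FE' => /bigcupP[C]; exists C.
have [[[_ cnt wt _] min] _ _] := fitE.
rewrite eqEcard FE; apply: min; split.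
- exact: subset_trans FE sE.
- by apply: le_trans cnt; rewrite lez_nat subset_leq_card.
- apply: le_trans wt; apply: ler_sum_subset => // x xE.
  exact/weight_ge0/(subsetP sE).
- move=> C hC; apply/set0Pn; exists (h C); rewrite inE.
  have [-> _] := univP (hP C hC); apply/forall_inP => u /setD1P[uc uC].
  by apply/bigcupP; exists C => //; apply: star_mem.
Qed.

Variable u0 : V.

(** The default [u0] is not reached on communities, whose universal sets are nonempty. *)
Definition fit_center C : V := odflt u0 [pick u in univ E' C].
Local Notation g := fit_center.

Lemma fit_centerP C : C \in CC -> g C \in univ E' C.
Proof.
move=> hC; rewrite /g; case: pickP => //= no.
have [[[_ _ _ un] _] _ _] := fitE.
by have /set0Pn[u uC] := un C hC; have := no u; rewrite uC.
Qed.

(** Otherwise a triangle, if [g D'] lies in [D], or else a square through a second shared vertex,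
    yields local edges at the shared vertex [z] inside both [D] and [D'], so [z] is isolated in
    neither. *)
Lemma fit_center_linked D D' :
  D \in CC -> D' \in CC -> linked 2 D D' -> g D \in D'.
Proof.
move=> hD hD' /linkedP[D2 [z [zD zD' zi]]].
have gP := fit_centerP hD; have gP' := fit_centerP hD'.
have [gD gE] := univP gP; have [gD' gE'] := univP gP'.
have [DD'|DD'] := eqVneq D D'; first by rewrite -DD'.
have [->//|gg] := eqVneq (g D) (g D').
apply: contraT => ngD.
have notg x : x \in D' -> x != g D by apply: contraTneq => ->.
have bad1 x : x \in D -> x != z -> [set z; x] \in Es -> ~~ isolated D z.
  by move=> xD xz zx; apply/isolatedPn; exists x.
have bad2 x : x \in D' -> x != z -> [set z; x] \in Es -> ~~ isolated D' z.
  by move=> xD xz zx; apply/isolatedPn; exists x.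
suff [i1 i2] : ~~ isolated D z /\ ~~ isolated D' z.
  by move: zi; rewrite (negPf i1) (negPf i2).
have [w /setIP[wD wD'] wz] := exists_other z D2.
have [g'D|g'D] := boolP (g D' \in D).
  have tri x := @local_triangle D D' (g D) (g D') x hD hD' DD' gP gP' gg g'D.
  have [zg|zg] := eqVneq z (g D').
    have [] := tri w wD wD' (notg _ wD'); first by rewrite -zg.
    rewrite -zg => t1 t2 t3; split; last exact: (bad2 w).
    by apply: (bad1 (g D)) => //; [rewrite eq_sym notg | rewrite setUC].
  have [//|t1 t2 t3] := tri z zD zD' (notg _ zD').
  split; [apply: (bad1 (g D))|apply: (bad2 (g D'))] => //; rewrite 1?setUC //.
    by rewrite eq_sym notg.
  by rewrite eq_sym.
have notg' x : x \in D -> x != g D' by apply: contraTneq => ->.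
have [] := @local_square D D' (g D) (g D') z w hD hD' DD' gP gP' gg;
  rewrite ?notg ?notg' // 1?eq_sym // => t1 t2.
split; [apply: (bad1 (g D))|apply: (bad2 (g D'))] => //; rewrite 1?setUC //.
  by rewrite eq_sym notg.
by rewrite eq_sym notg'.
Qed.

Lemma linkedW D D' : linked 3 D D' -> linked 2 D D'.
Proof. by case/linkedP => h1 h2; apply/linkedP; split=> //; apply: ltnW. Qed.

(** Both centers lie in both communities. If they differ, each further shared vertex forms a local
    triangle with them, so every shared vertex has a local edge inside [D :&: D'], and none is
    isolated. *)
Lemma fit_center_eq D D' :
  D \in CC -> D' \in CC -> linked 3 D D' -> g D = g D'.
Proof.
move=> hD hD' l3.
have gD' := fit_center_linked hD hD' (linkedW l3).
have g'D : g D' \in D.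
  by apply: fit_center_linked => //; rewrite linked_sym linkedW.
case/linkedP: l3 => D3 [z [zD zD' zi]].
have gP := fit_centerP hD; have gP' := fit_centerP hD'.
have [gD _] := univP gP; have [g'D' _] := univP gP'.
have [->//|DD'] := eqVneq D D'.
have [//|gg] := eqVneq (g D) (g D').
have tri x := @local_triangle D D' (g D) (g D') x hD hD' DD' gP gP' gg g'D.
have bad x : x \in D -> x \in D' -> x != z -> [set z; x] \in Es -> False.
  move=> xD xD' xz zx; move: zi; apply/negP; rewrite negb_or; apply/andP.
  by split; apply/isolatedPn; exists x.
have [w [/setIP[wD wD'] wg wg']] := exists_third (g D) (g D') D3.
have [s1 s2 s3] := tri w wD wD' wg wg'.
have [zg|zg] := eqVneq z (g D).
  by case: (bad (g D')); rewrite // zg // eq_sym.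
have [zg'|zg'] := eqVneq z (g D').
  by case: (bad (g D)); rewrite // zg' // setUC.
have [t1 t2 t3] := tri z zD zD' zg zg'.
by case: (bad (g D)); rewrite // 1?eq_sym // setUC.
Qed.

Lemma fit_center_valid D : D \in CC -> valid D (g D).
Proof.
move=> hD; have gP := fit_centerP hD; have [gD gE] := univP gP.
apply/validP; split=> //.
- by move=> u uD uc; apply: (subsetP sE); apply: gE.
(* A local edge of [D] avoiding [g D] belongs to the star of another community [D'], by minimality.
   Its two ends form a local triangle with [g D], so [g D] is joined to [u] by a local edge. *)
- move=> u uD uc /isolatedPn[y [yD yu uy]].
  have [<-|yg] := eqVneq y (g D); first by rewrite setUC.
  have [D' hD' st] := min_star (subsetP EsE' _ uy) fit_centerP.
  have gP' := fit_centerP hD'; have [g'D' _] := univP gP'.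
  case/imsetP: st => t; rewrite !inE => /andP[tg' tD'] eq.
  have inD x : x \in [set u; y] -> x \in D /\ x != g D.
    by rewrite !inE => /orP[]/eqP->.
  have [g'D g'g] : g D' \in D /\ g D' != g D by apply: inD; rewrite eq !inE eqxx.
  have [tD tg] : t \in D /\ t != g D by apply: inD; rewrite eq !inE eqxx orbT.
  have DD' : D != D' by apply: contraNneq g'g => ->.
  have [] := local_triangle hD hD' DD' gP gP' _ g'D tD tD' tg tg'.
    by rewrite eq_sym.
  move=> t1 t2 t3; have : u \in [set u; y] by rewrite !inE eqxx.
  by rewrite eq !inE => /orP[]/eqP->.
- by move=> D' hD'; apply: fit_center_linked.
Qed.

Lemma fit_center_class C D : C \in CC -> D \in class C -> g D = g C.
Proof.
move=> hC; rewrite mem_class // => /andP[_ /connectP[p pp ->]].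
elim: p C hC pp => //= D' p IH C hC /andP[/and3P[_ hD' l] pp].
by rewrite IH // (fit_center_eq hC hD' l).
Qed.

Lemma fit_center_candidate C : C \in CC -> all (valid^~ (g C)) (class C).
Proof.
move=> hC; apply/allP => D DC; rewrite -(fit_center_class hC DC).
by apply: fit_center_valid; move: DC; rewrite mem_class // => /andP[].
Qed.

Lemma fit_found : found_all Es.
Proof.
apply/allP => C; rewrite mem_enum => hC.
have := centerP C; case: (center C) => // /(_ (g C)).
by rewrite fit_center_candidate.
Qed.

(** * Comparing the output with a fitting solution *)

Definition best_center C : V := odflt u0 (center C).
Local Notation a := best_center.

Lemma best_centerP C : C \in CC ->
  [/\ center C = Some (a C), all (valid^~ (a C)) (class C) &
    (class_weight (class C) (a C) <= class_weight (class C) (g C))%R].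
Proof.
move=> hC; have := centerP C; rewrite /a.
have := allP fit_found C; rewrite mem_enum => /(_ hC).
case: (center C) => //= c _ [vc min]; split=> //; apply: min.
exact: fit_center_candidate.
Qed.

Lemma best_center_valid C : C \in CC -> valid C (a C).
Proof. by move=> hC; have [_ /allP h _] := best_centerP hC; apply/h/class_self. Qed.

Lemma best_center_class C D : C \in CC -> D \in class C -> a D = a C.
Proof. by move=> hC DC; rewrite /a /center (class_eq hC DC). Qed.

(** The total charge when each [D] takes the center [h D]; [f] is the weight, or constantly 1 to
    count edges. *)
Definition owned_sum (f : {set V} -> R) (h : {set V} -> V) : R :=
  (\sum_(D in CC) \sum_(u in [set u in D | owned D (h D) u]) f [set h D; u])%R.

Lemma owned_sum_imset (f : {set V} -> R) D c :
  (\sum_(u in [set u in D | owned D c u]) f [set c; u] =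
   \sum_(e in [set [set c; u] | u in [set u in D | owned D c u]]) f e)%R.
Proof.
rewrite big_imset //= => u v; rewrite !inE !ownedE.
move=> /andP[_ /and3P[uc _ _]] /andP[_ /and3P[vc _ _]] /setP/(_ u).
by rewrite !inE eqxx orbT (negPf uc) => /esym/eqP.
Qed.

(** Let [e] be kept because of [C]. Its end other than [a C] is isolated in [C], so [C] is linked to
    the owner [D]. If they share three vertices, their centers agree; if not, [e] is [C :&: D], and
    linkage puts [a D] into it. *)
Lemma output_owner e :
  e \in output -> e \notin Es ->
  [/\ edge_owner e \in CC, e \subset edge_owner e & a (edge_owner e) \in e].
Proof.
move=> eo eEs; move: eo; rewrite inE => /andP[eE /orP[/hasP[e' e'Es /eqP ee']|]].
  by move: e'Es; rewrite ee' mem_enum (negPf eEs).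
case/hasP => C; rewrite mem_enum => hC /andP[eC].
have [-> _ _] := best_centerP hC => ae.
have [hD eD] := edge_ownerP hC eC; split=> //; set D := edge_owner e in hD eD *.
have [u ua eau] := card2_split (edges_card2 eE) ae.
have uC : u \in C by apply: (subsetP eC); rewrite eau !inE eqxx orbT.
have uD : u \in D by apply: (subsetP eD); rewrite eau !inE eqxx orbT.
have eCD : e \subset C :&: D by rewrite subsetI eC.
have CD2 : 2 <= #|C :&: D| by rewrite -(edges_card2 eE) subset_leq_card.
have /validP[_ _ iso _] := best_center_valid hC.
have iu : isolated C u.
  by apply: contraR eEs => nu; rewrite eau iso.
have lnk k : k <= #|C :&: D| -> linked k C D.
  by move=> kCD; apply/linkedP; split=> //; exists u; rewrite iu.
have [CD3|CD3] := leqP 3 #|C :&: D|.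
  by rewrite (best_center_class hC (linked_class hC hD (lnk _ CD3))).
have eqe : e = C :&: D.
  by apply/eqP; rewrite eqEcard eCD (edges_card2 eE).
have /validP[aD _ _ alink] := best_center_valid hD.
by rewrite eqe inE aD andbT alink // linked_sym lnk.
Qed.

(** Grouped by owner, each non-local output edge lies at the center of its owner and is therefore
    counted there. *)
Lemma output_owned_sum (f : {set V} -> R) :
  (forall e, e \in E -> 0 <= f e)%R ->
  (\sum_(e in output :\: Es) f e <= owned_sum f a)%R.
Proof.
move=> f0; rewrite (partition_big edge_owner (mem CC)) /=; last first.
  by move=> e; rewrite in_setD => /andP[eEs eo]; have [] := output_owner eo eEs.
apply: ler_sum => D hD; rewrite owned_sum_imset.
have -> : (\sum_(e in output :\: Es | edge_owner e == D) f e =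
    \sum_(e in [set e in output :\: Es | edge_owner e == D]) f e)%R.
  by apply: eq_bigl => e; rewrite !inE.
apply: ler_sum_subset => [|e /imsetP[u]].
  apply/subsetP => e; rewrite inE in_setD => /andP[/andP[eEs eo] /eqP ow].
  have [_ eD ae] := output_owner eo eEs; rewrite ow in ae eD.
  have eE : e \in E by move: eo; rewrite inE => /andP[].
  have [u ua eau] := card2_split (edges_card2 eE) ae.
  apply/imsetP; exists u => //; rewrite inE ownedE -eau eEs ow ua eqxx !andbT.
  by apply: (subsetP eD); rewrite eau !inE eqxx orbT.
rewrite inE ownedE => /andP[uD /and3P[ua _ _]] ->.
by apply: f0; have /validP[_ h _ _] := best_center_valid hD; apply: h.
Qed.

(** The edges charged to [D] are non-local star edges of [E'], and charges to different owners are
    disjoint. *)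
Lemma fit_owned_sum (f : {set V} -> R) :
  (forall e, e \in E -> 0 <= f e)%R ->
  (owned_sum f g <= \sum_(e in E' :\: Es) f e)%R.
Proof.
move=> f0; rewrite (partition_big edge_owner (mem CC)) /=; last first.
  move=> e; rewrite inE => /andP[_ eE].
  have [C hC] := min_star eE fit_centerP => /imsetP[u /setD1P[uc uC] ee].
  have [gC _] := univP (fit_centerP hC).
  have eC : e \subset C by rewrite ee subUset !sub1set gC.
  by have [] := edge_ownerP hC eC.
apply: ler_sum => D hD; rewrite owned_sum_imset.
have -> : (\sum_(e in E' :\: Es | edge_owner e == D) f e =
    \sum_(e in [set e in E' :\: Es | edge_owner e == D]) f e)%R.
  by apply: eq_bigl => e; rewrite !inE.
apply: ler_sum_subset => [|e]; last first.
  by rewrite !inE => /andP[/andP[_ eE] _]; apply/f0/(subsetP sE).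
apply/subsetP => e /imsetP[u]; rewrite inE ownedE => /andP[uD /and3P[ug nE ow]] ->.
rewrite inE in_setD nE ow /= andbT.
by have [_] := univP (fit_centerP hD); apply.
Qed.

Lemma class_weightE C c : C \in CC -> all (valid^~ c) (class C) ->
  class_weight (class C) c =
  (\sum_(D <- class C) \sum_(u in [set u in D | owned D c u]) weight I [set c; u])%R.
Proof.
move=> hC /allP vc; apply: eq_big_seq => D DC.
rewrite big_enum -big_mkcondr; apply: eq_big => [u|u /andP[uD]]; first by rewrite inE.
rewrite ownedE => /and3P[uc _ _]; rewrite pair_weightE 1?eq_sym //.
by have /validP[_ h _ _] := vc D DC; apply: h.
Qed.

(** On each class both [a] and [g] are constant, so the part of the sum over it is a [class_weight],
    which [a] minimizes. *)
Lemma owned_sum_weight : (owned_sum (weight I) a <= owned_sum (weight I) g)%R.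
Proof.
pose kappa D := [set D' in class D].
rewrite /owned_sum (partition_big kappa xpredT) //.
rewrite [leRHS](partition_big kappa xpredT) //; apply: ler_sum => K _.
have [C /andP[hC /eqP CK]|no] :=
  pickP (fun C => (C \in CC) && (kappa C == K)); last first.
  by rewrite !big_pred0.
have mK D : (D \in CC) && (kappa D == K) = (D \in class C).
  apply/andP/idP => [[hD /eqP DK]|DC].
    have : D \in kappa D by rewrite inE class_self.
    by rewrite DK -CK inE.
  have hD : D \in CC by move: DC; rewrite mem_class // => /andP[].
  by split=> //; rewrite /kappa (class_eq hC DC) -/(kappa C) CK.
have sumK (F : {set V} -> R) :
    (\sum_(D in CC | kappa D == K) F D = \sum_(D <- class C) F D)%R.
  rewrite (eq_bigl _ _ mK) big_uniq //; exact/filter_uniq/enum_uniq.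
have [_ va le_w] := best_centerP hC.
move: le_w; rewrite !class_weightE ?fit_center_candidate // !sumK.
set A1 := (\sum_(D <- _) _)%R; set B1 := (\sum_(D <- _) _)%R.
set A2 := (\sum_(D <- _) _)%R; set B2 := (\sum_(D <- _) _)%R.
have -> : A2 = A1 by apply: eq_big_seq => D DC; rewrite (best_center_class hC DC).
by have -> : B2 = B1 by apply: eq_big_seq => D DC; rewrite (fit_center_class hC DC).
Qed.

Lemma owned_sum_card :
  (owned_sum (fun=> 1) a = owned_sum (fun=> 1) g)%R.
Proof.
apply: eq_bigr => D hD; rewrite !sumr_const; congr (_ *+ _)%R.
by apply: card_owned => //; [exact: best_center_valid | exact: fit_center_valid].
Qed.

(** Both edge sets contain all local edges, so only the charged non-local ones need comparing. *)
Lemma output_le (f : {set V} -> R) :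
  (forall e, e \in E -> 0 <= f e)%R -> (owned_sum f a <= owned_sum f g)%R ->
  (\sum_(e in output) f e <= \sum_(e in E') f e)%R.
Proof.
move=> f0 fag; rewrite (big_setID Es) [leRHS](big_setID Es) /=.
rewrite (setIidPr local_sub_output) (setIidPr EsE') lerD2l.
exact: le_trans (output_owned_sum f0) (le_trans fag (fit_owned_sum f0)).
Qed.

Lemma accept_inhabited : accept Es.
Proof.
have [[[_ cnt wt _] _] _ _] := fitE.
rewrite /accept fit_found /=; apply/andP; split.
  apply: le_trans cnt; rewrite lez_nat -(ler_nat R).
  have := @output_le (fun=> 1%R); rewrite !sumr_const; apply=> //.
  by rewrite owned_sum_card.
exact: le_trans (output_le (@weight_ge0 _ I) owned_sum_weight) wt.
Qed.

End Fitting.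

Lemma accept_complete (E' : {set {set V}}) : fitting Es E' -> accept Es.
Proof.
(* Without vertices there is no default center; then there are no edges, and no community can have a
   universal vertex. *)
move=> fitE; have [u0 _|noV] := pickP (fun _ : V => true).
  exact: (accept_inhabited fitE u0).
have [[[sE cnt wt un] _] _ _] := fitE.
have E0 : E = set0.
  apply/setP => e; rewrite inE; apply/negP => /edges_card2 e2.
  have /card_gt0P[x _] : 0 < #|e| by rewrite e2.
  by have := noV x.
have O0 : output = set0 by apply/setP => e; rewrite !inE E0 inE.
have E'0 : E' = set0 by apply/eqP; rewrite -subset0 -E0.
rewrite /accept O0 -E'0 cnt wt !andbT; apply/allP => C; rewrite mem_enum => hC.
by have /set0Pn[x] := un C hC; have := noV x.
Qed.

End Correctness.

(** * Input size and the polynomial-time statement *)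

Lemma size_le_data_size (R : realType) (s : seq (data R)) :
  size s < data_size (enc_list s).
Proof. by elim: s => //= x s IH; rewrite ltnS (leq_trans IH) // leq_addl. Qed.

Lemma data_size_nth (R : realType) (s : seq (data R)) i :
  i < size s -> data_size (nth Nil s i) <= data_size (enc_list s).
Proof.
elim: s i => //= x s IH [_|i /IH h] /=; first by rewrite -addnS leq_addr.
by rewrite (leq_trans h) // -addSn leq_addl.
Qed.

Lemma enc_input_sizes (R : realType) (I : instance R) (Es : {set {set 'I_(nverts I)}}) :
  [/\ nverts I <= data_size (enc_input Es),
      #|edges I| <= data_size (enc_input Es),
      #|comms I| <= data_size (enc_input Es) &
      #|Es| <= data_size (enc_input Es)].
Proof.
have bound (B : finType) (f : B -> data R) (A : {set B}) :
    #|A| < data_size (enc_list (map f (enum A))).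
  by rewrite cardE -(size_map f); exact: size_le_data_size.
have nV : #|[set: 'I_(nverts I)]| = nverts I by rewrite cardsT card_ord.
have part i m : i < 6 ->
    m < data_size (nth Nil [:: enc_vset R [set: 'I_(nverts I)];
      enc_list [seq Pair (enc_vset R e) (Num (weight I e)) | e <- enum (edges I)];
      enc_vsets R (enum (comms I)); Num (max_edges I)%:~R%R; Num (budget I);
      enc_vsets R (enum Es)] i) -> m <= data_size (enc_input Es).
  by move=> i6 /ltnW/leq_trans; apply; apply: data_size_nth.
split; [rewrite -{1}nV; apply: (@part 0)|apply: (@part 1)|apply: (@part 2)|
  apply: (@part 5)] => //; exact: bound.
Qed.

Theorem theorem10 (R : realType) :
  exists (P : program) (c k : nat),
  forall (I : instance R) (Es : {set {set 'I_(nverts I)}}),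
  Es \subset edges I ->
  exists (v : data R) (t : nat),
    [/\ run P (enc_input Es) v t,
        (t <= c * data_size (enc_input Es) ^ k + c)%N &
        (exists E' : {set {set 'I_(nverts I)}},
           [/\ answers_edges v E', solution E' & Es \subset E'])
        \/ (answers_no v /\
            ~ exists E' : {set {set 'I_(nverts I)}}, fitting Es E')].
Proof.
have [c [k ck]] := time_bound_poly hmain.
(* The 4 pays for the steps with which the entry point packs the input. *)
exists main_program, (c + 4), k => I Es EsE.
set N := data_size (enc_input Es).
have [nN EN CN EsN] := enc_input_sizes Es.
have N0 : 0 < N by rewrite /N /enc_input.
have [|t et lt] := hval_main nN EN CN EsN (P := main_program) (o := 1) [:: enc_input Es].
  by [].
set v := (if accept Es then _ else _) in et.
exists v, ((1 + 1).+1 + t).+1; split.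
- apply: eval_let et; apply: eval_pair; last exact: eval_nil.
  exact: (eval_var _ [:: enc_input Es] 0).
- by have := leq_trans lt (ck N N0); rewrite mulnDl; lia.
rewrite /v; case: ifP => acc; last first.
  by right; split=> // -[E' /(accept_complete EsE)]; rewrite acc.
left; exists (output Es); split; [|exact: accept_sound|exact: local_sub_output].
eexists; split; first by [].
by apply/setP => e; rewrite !inE mem_filter mem_enum andbC.
Qed.
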